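(* Let $p$ be a prime, let $\mathcal{F}$ be a saturated fusion system over a finite $p$-group $S$, and let $\mathcal{C}$ be a non-empty closed $\mathcal{F}$-collection. Then the simplicial set $N(\mathcal{C})/\mathcal{F}$ admits a Morse matching in which the set of critical cells consists of one cell, of dimension $0$, and hence $N(\mathcal{C})/\mathcal{F}$ is contractible.
   Context: Fusion systems. Let $S$ be a finite $p$-group. A fusion system over $S$ is a category $\mathcal{F}$ whose objects are the subgroups of $S$, such that for all $P,Q\le S$ one has $\operatorname{Hom}_S(P,Q)\subseteq\operatorname{Hom}_{\mathcal{F}}(P,Q)\subseteq\operatorname{Inj}(P,Q)$, where $\operatorname{Inj}(P,Q)$ is the set of injective group homomorphisms $P\to Q$ and $\operatorname{Hom}_S(P,Q)$ is the set of maps $c_g:x\mapsto g^{-1}xg$ with $g\in S$ and $g^{-1}Pg\le Q$, and such that each $\varphi\in\operatorname{Hom}_{\mathcal{F}}(P,Q)$ is the composite of an isomorphism in $\mathcal{F}$ followed by an inclusion (composition in $\mathcal{F}$ is composition of homomorphisms). Subgroups $P,Q\le S$ are $\mathcal{F}$-conjugate if they are isomorphic as objects of $\mathcal{F}$. Saturation (Aschbacher–Kessar–Oliver, Definition 2.2). Write $\operatorname{Aut}_S(P)=\operatorname{Hom}_S(P,P)$ and $\operatorname{Aut}_{\mathcal{F}}(P)=\operatorname{Hom}_{\mathcal{F}}(P,P)$. A subgroup $P\le S$ is fully automized if $\operatorname{Aut}_S(P)$ is a Sylow $p$-subgroup of $\operatorname{Aut}_{\mathcal{F}}(P)$. It is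 receptive if for every $Q\le S$ and every isomorphism $\varphi:Q\to P$ in $\mathcal{F}$, there is $\bar\varphi\in\operatorname{Hom}_{\mathcal{F}}(N_\varphi,S)$ with $\bar\varphi|_Q=\varphi$, where $N_\varphi=\{g\in N_S(Q)\mid \varphi\circ c_g\circ\varphi^{-1}\in\operatorname{Aut}_S(P)\}$. $\mathcal{F}$ is saturated if every subgroup of $S$ is $\mathcal{F}$-conjugate to a subgroup that is fully automized and receptive. Collections and quotient nerve. An $\mathcal{F}$-collection is a union of $\mathcal{F}$-conjugacy classes of subgroups of $S$. An $\mathcal{F}$-collection $\mathcal{C}$ is closed if every subgroup $Q\le S$ that contains an element of $\mathcal{C}$ belongs to $\mathcal{C}$. $\mathcal{C}$ is a poset under inclusion and $N(\mathcal{C})$ is its nerve: the simplicial set whose $n$-simplices are chains $(P_0\le\cdots\le P_n)$ in $\mathcal{C}$, with face maps deleting and degeneracy maps repeating an entry. Define $(P_0,\dots,P_n)\sim_{\mathcal{F}}(Q_0,\dots,Q_n)$ if there is an isomorphism $\varphi\in\operatorname{Hom}_{\mathcal{F}}(P_n,Q_n)$ with $\varphi(P_i)=Q_i$ for all $0\le i\le n$. $N(\mathcal{C})/\mathcal{F}$ is the quotient simplicial set $N(\mathcal{C})/\!\sim_{\mathcal{F}}$. A simplicial set is called contractible if its geometric realization is. Morse matchings. Let $X$ be a simplicial set; a cell of $X$ means a nondegenerate simplex. Suppose given (1) a partition of the cells of $X$ into critical, redundant and collapsible cells; (2) a bijection $c$ from the set of redundant cells to the set of collapsible cells such that for each redundant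 $n$-cell $\tau$, $c(\tau)$ is an $(n+1)$-cell and $\tau$ is a face of $c(\tau)$; (3) for each redundant $n$-cell $\tau$, a choice of index $\iota(\tau)\in\{0,1,\dots,n+1\}$ such that $\tau=d_{\iota(\tau)}(c(\tau))$, where $d_i$ is the $i$-th face map. Let $D$ be the digraph whose vertices are the redundant and collapsible cells and whose edges are $\tau\to c(\tau)$ for $\tau$ redundant, and $\sigma\to d_j(\sigma)$ for $\sigma$ collapsible and $j\neq\iota(c^{-1}(\sigma))$ (whenever $d_j(\sigma)$ is a vertex of $D$). These data form a Morse matching for $X$ if $D$ has no infinite directed path. *)

(* Defs.v *)
From HB Require Import structures.
From mathcomp Require Import all_boot all_order all_algebra.
From mathcomp Require Import all_fingroup all_solvable generic_quotient.
Import Order.TTheory GRing.Theory Num.Theory.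

Set Implicit Arguments.
Unset Strict Implicit.
Unset Printing Implicit Defensive.

(** A homomorphism P -> Q between subgroups of gT is represented by the unique
    finite function gT -> gT that agrees with it on P and is 1 off P. Equality
    of homomorphisms is then Leibniz equality, and this normal form is stable
    under composition of functions. *)

Section FusionSystems.
Local Open Scope group_scope.
Variable gT : finGroupType.
Implicit Types (P Q R S : {group gT}) (phi psi : {ffun gT -> gT}).
Implicit Type hom : {group gT} -> {group gT} -> {set {ffun gT -> gT}}.

Definition restr (P : {set gT}) (f : gT -> gT) : {ffun gT -> gT} :=
  [ffun x => if x \in P then f x else 1].

Definition hcomp psi phi : {ffun gT -> gT} := [ffun x => psi (phi x)].

Definition incl P := restr P id.

Definition conj_map P (g : gT) := restr P (fun x => x ^ g).

Definition InjHom P Q : {set {ffun gT -> gT}} :=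
  [set phi : {ffun gT -> gT} | [&& morphic P phi, dinjectiveb phi (mem P),
                 phi @: P \subset Q & phi == restr P phi]].

Definition HomS S P Q : {set {ffun gT -> gT}} :=
  [set conj_map P g | g in S & P :^ g \subset Q].

Definition inverse_isos hom P Q phi psi : bool :=
  [&& phi \in hom P Q, psi \in hom Q P,
      hcomp psi phi == incl P & hcomp phi psi == incl Q].

Definition is_iso hom P Q phi : bool :=
  [exists psi, inverse_isos hom P Q phi psi].

(** Only the values of [fhom] on subgroups of S are meaningful. *)
Record fusion_system S := FusionSystem {
  fhom : {group gT} -> {group gT} -> {set {ffun gT -> gT}};
  fhom_HomS : forall P Q, P \subset S -> Q \subset S ->
    HomS S P Q \subset fhom P Q;
  fhom_inj : forall P Q, P \subset S -> Q \subset S ->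
    fhom P Q \subset InjHom P Q;
  fhom_comp : forall P Q R phi psi,
    P \subset S -> Q \subset S -> R \subset S ->
    phi \in fhom P Q -> psi \in fhom Q R -> hcomp psi phi \in fhom P R;
  fhom_factor : forall P Q phi, P \subset S -> Q \subset S ->
    phi \in fhom P Q ->
    exists R psi,
      [/\ R \subset Q, is_iso fhom P R psi & phi = hcomp (incl R) psi]
}.

Section Saturation.
Variables (S : {group gT}) (F : fusion_system S).

Definition fconj P Q : bool := [exists phi, is_iso (fhom F) P Q phi].

(** The subgroup of [Aut P] of those automorphisms that lie in [hom P P]. *)
Definition aut_in hom P : {set {perm gT}} :=
  [set a in Aut P | restr P a \in hom P P].

Definition fully_automized (p : nat) P : bool :=
  p.-Sylow(aut_in (fhom F) P) (aut_in (HomS S) P).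

(** N_phi for an isomorphism phi : Q -> P with inverse psi. *)
Definition Nphi Q P phi psi : {set gT} :=
  [set g in 'N_S(Q) | hcomp phi (hcomp (conj_map Q g) psi) \in HomS S P P].

Definition receptive P : Prop :=
  forall Q phi psi, Q \subset S -> inverse_isos (fhom F) Q P phi psi ->
  exists2 phibar, phibar \in fhom F <<Nphi Q P phi psi>>%G S
                & restr Q phibar = phi.

Definition saturated (p : nat) : Prop :=
  forall P, P \subset S ->
  exists Q, [/\ Q \subset S, fconj P Q, fully_automized p Q & receptive Q].

Definition fclass P : {set {group gT}} :=
  [set Q : {group gT} | (Q \subset S) && fconj P Q].

Record fcollection := FCollection {
  fcoll :> {set {group gT}};
  fcollP : exists2 A : {set {group gT}},
    A \subset subgroups S & fcoll = \bigcup_(P in A) fclass P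
}.

Definition fclosed_coll (C : fcollection) : Prop :=
  forall P Q, P \in (C : {set _}) -> P \subset Q -> Q \subset S ->
  Q \in (C : {set _}).

End Saturation.

Lemma restrE (P : {set gT}) f x : x \in P -> restr P f x = f x.
Proof. by rewrite ffunE => ->. Qed.

Lemma hcompA (a b c : {ffun gT -> gT}) : hcomp a (hcomp b c) = hcomp (hcomp a b) c.
Proof. by apply/ffunP=> x; rewrite !ffunE. Qed.

Section Theory.
Variables (S : {group gT}) (F : fusion_system S).

Lemma fhomP P Q phi : P \subset S -> Q \subset S -> phi \in fhom F P Q ->
  [/\ {in P &, {morph phi : x y / x * y}}, {in P &, injective phi},
      phi @: P \subset Q & forall x, x \notin P -> phi x = 1].
Proof.
move=> sP sQ h; have := subsetP (fhom_inj F sP sQ) _ h.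
rewrite inE => /and4P[/morphicP hm /dinjectiveP hi hs /eqP hr]; split => //.
by move=> x xP; rewrite hr ffunE (negbTE xP).
Qed.

Lemma incl_fhom P Q : P \subset Q -> Q \subset S -> incl P \in fhom F P Q.
Proof.
move=> sPQ sQ; have sP := subset_trans sPQ sQ.
apply: (subsetP (fhom_HomS F sP sQ)); apply/imsetP; exists 1.
  by rewrite inE group1 conjsg1.
by apply/ffunP=> x; rewrite !ffunE conjg1.
Qed.

Lemma hcomp_incl P Q phi : P \subset S -> Q \subset S -> phi \in fhom F P Q ->
  hcomp phi (incl P) = phi /\ hcomp (incl Q) phi = phi.
Proof.
move=> sP sQ /(fhomP sP sQ)[hm _ hs h1].
have p1 : phi 1 = 1.
  by apply: (mulgI (phi 1)); rewrite -hm ?group1 // !mulg1.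
split; apply/ffunP=> x; rewrite !ffunE.
  by case: ifPn => // /h1 ->.
case: ifPn => // xQ; case: (boolP (x \in P)) => [xP|/h1 //].
by rewrite (subsetP hs) ?imset_f in xQ.
Qed.

Lemma inverse_isosP P Q phi psi : P \subset S -> Q \subset S ->
  inverse_isos (fhom F) P Q phi psi ->
  [/\ phi @: P = Q :> {set gT}, {in P, cancel phi psi} & {in Q, cancel psi phi}].
Proof.
move=> sP sQ /and4P[h1 h2 /eqP e1 /eqP e2].
have k1 : {in P, cancel phi psi}.
  by move=> x xP; have /ffunP/(_ x) := e1; rewrite !ffunE xP.
have k2 : {in Q, cancel psi phi}.
  by move=> x xP; have /ffunP/(_ x) := e2; rewrite !ffunE xP.
have [_ _ s1 _] := fhomP sP sQ h1; have [_ _ s2 _] := fhomP sQ sP h2.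
split=> //; apply/eqP; rewrite eqEsubset s1 /=; apply/subsetP=> y yQ.
by rewrite -(k2 y yQ) imset_f // (subsetP s2) ?imset_f.
Qed.

Lemma inverse_isos_sym P Q phi psi :
  inverse_isos (fhom F) P Q phi psi -> inverse_isos (fhom F) Q P psi phi.
Proof. by case/and4P=> *; apply/and4P. Qed.

Lemma is_iso_refl P : P \subset S -> is_iso (fhom F) P P (incl P).
Proof.
move=> sP; have h := incl_fhom (subxx P) sP.
apply/existsP; exists (incl P); rewrite /inverse_isos h.
by rewrite (hcomp_incl sP sP h).1 eqxx.
Qed.

Lemma inverse_isos_comp P Q R phi phi' psi psi' :
  P \subset S -> Q \subset S -> R \subset S ->
  inverse_isos (fhom F) P Q phi phi' -> inverse_isos (fhom F) Q R psi psi' ->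
  inverse_isos (fhom F) P R (hcomp psi phi) (hcomp phi' psi').
Proof.
move=> sP sQ sR /and4P[a1 a2 /eqP a3 /eqP a4] /and4P[b1 b2 /eqP b3 /eqP b4].
apply/and4P; split.
- exact: fhom_comp a1 b1.
- exact: fhom_comp b2 a2.
- by apply/eqP; rewrite hcompA -(hcompA phi') b3 (hcomp_incl sQ sP a2).1.
by apply/eqP; rewrite hcompA -(hcompA psi) a4 (hcomp_incl sQ sR b1).1.
Qed.

Lemma is_iso_restr P Q P' Q' phi :
  P \subset S -> Q \subset S -> P' \subset P -> Q' \subset Q ->
  is_iso (fhom F) P Q phi -> phi @: P' = Q' :> {set gT} ->
  is_iso (fhom F) P' Q' (restr P' phi).
Proof.
move=> sP sQ sP' sQ' /existsP[psi hi] e.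
have sPS := subset_trans sP' sP; have sQS := subset_trans sQ' sQ.
have h1 : phi \in fhom F P Q by case/and4P: hi.
have h2 := fhom_comp sPS sP sQ (incl_fhom sP' sP) h1.
have [R [chi [sR hchi e2]]] := fhom_factor sPS sQ h2.
have sRS := subset_trans sR sQ.
have /existsP[chi' hc] := hchi.
have hc1 : chi \in fhom F P' R by case/and4P: hc.
have [ec _ _] := inverse_isosP sPS sRS hc.
rewrite (hcomp_incl sPS sRS hc1).2 in e2.
have e3 : restr P' phi = chi.
  have [_ _ _ h1'] := fhomP sPS sRS hc1.
  apply/ffunP=> x; rewrite ffunE -e2 !ffunE.
  case: ifPn => // xP'; move/ffunP: e2 => /(_ x).
  by rewrite !ffunE (negbTE xP') h1' // => ->.
suff -> : Q' = R by rewrite e3.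
apply: val_inj; rewrite /= -e -ec; apply: eq_in_imset => x xP'.
by rewrite -e3 restrE.
Qed.

(** [Nphi] is already a subgroup: the [<<_>>] in [receptive] only supplies the
    group structure. *)
Lemma group_set_Nphi Q P phi psi : Q \subset S -> P \subset S ->
  inverse_isos (fhom F) Q P phi psi -> group_set (Nphi S Q P phi psi).
Proof.
move=> sQ sP hi.
have [eP k1 k2] := inverse_isosP sQ sP hi.
have [eQ _ _] := inverse_isosP sP sQ (inverse_isos_sym hi).
have [h1 h2 _ /eqP i2] := and4P hi.
have psiQ y : y \in P -> psi y \in Q by move=> yP; rewrite -eQ imset_f.
have NP g : (g \in Nphi S Q P phi psi) <->
  (g \in 'N_S(Q) /\ exists2 h, h \in 'N_S(P) &
      forall y, y \in P -> phi (psi y ^ g) = y ^ h).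
  have [_ _ _ n1] := fhomP sP sQ h2.
  have p1 : phi 1 = 1.
    have [hm _ _ _] := fhomP sQ sP h1.
    by apply: (mulgI (phi 1)); rewrite -hm ?group1 // !mulg1.
  rewrite inE; split.
    case/andP=> gN /imsetP[h]; rewrite inE => /andP[hS hN] /ffunP e.
    split=> //; exists h; first by rewrite inE hS inE.
    by move=> y yP; have := e y; rewrite !ffunE psiQ // yP.
  case=> gN [h]; rewrite inE => /andP[hS]; rewrite inE => hN e; rewrite gN /=.
  apply/imsetP; exists h; first by rewrite inE hS.
  apply/ffunP=> y; rewrite !ffunE; case: (boolP (y \in P)) => yP.
    by rewrite psiQ // e.
  by rewrite n1 // group1 conj1g.
apply/group_setP; split.
  apply/NP; split; first exact: group1.
  exists 1; first exact: group1.
  by move=> y yP; rewrite !conjg1 k2.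
move=> g g' /NP[gN [h hN eh]] /NP[gN' [h' hN' eh']].
apply/NP; split; first exact: groupM.
exists (h * h'); first exact: groupM.
move=> y yP; rewrite !conjgM -eh //.
have yg : psi y ^ g \in Q.
  by rewrite memJ_norm ?psiQ //; case/setIP: gN.
have pP : phi (psi y ^ g) \in P by rewrite -eP imset_f.
by rewrite -eh' // k1.
Qed.

Lemma fcoll_sub (C : fcollection F) P : P \in (C : {set _}) -> P \subset S.
Proof.
case: C => C /= [A _ ->] /bigcupP[Q _]; rewrite inE; by case/andP.
Qed.

End Theory.
End FusionSystems.

Section Delta.

(** Morphisms [m] -> [n] of the simplex category: monotone maps from
    {0, ..., m} to {0, ..., n}. *)
Definition dmap (m n : nat) := {f : {ffun 'I_m.+1 -> 'I_n.+1} |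
  [forall i : 'I_m.+1, forall j : 'I_m.+1, (i <= j) ==> (f i <= f j)]}.

Definition dfun m n (f : dmap m n) : 'I_m.+1 -> 'I_n.+1 := val f.

Coercion dfun : dmap >-> Funclass.

Lemma dfun_homo m n (f : dmap m n) (i j : 'I_m.+1) : i <= j -> f i <= f j.
Proof. by have /forallP/(_ i)/forallP/(_ j)/implyP := valP f. Qed.

Lemma mk_dmap_subproof m n (f : 'I_m.+1 -> 'I_n.+1)
    (fh : forall i j : 'I_m.+1, i <= j -> f i <= f j) :
  [forall i : 'I_m.+1, forall j : 'I_m.+1,
    (i <= j) ==> ([ffun k => f k] i <= [ffun k => f k] j)].
Proof.
by apply/forallP => i; apply/forallP => j; apply/implyP => ij; rewrite !ffunE fh.
Qed.

Definition mk_dmap m n (f : 'I_m.+1 -> 'I_n.+1)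
    (fh : forall i j : 'I_m.+1, i <= j -> f i <= f j) : dmap m n :=
  Sub [ffun k => f k] (mk_dmap_subproof fh).

Lemma mk_dmapE m n f fh i : @mk_dmap m n f fh i = f i.
Proof. by rewrite /dfun /= ffunE. Qed.

Lemma dmapP m n (f g : dmap m n) : f =1 g -> f = g.
Proof. by move=> fg; apply/val_inj/ffunP. Qed.

Definition did n : dmap n n := @mk_dmap n n id (fun _ _ h => h).

Lemma dcomp_subproof l m n (g : dmap m n) (f : dmap l m) (i j : 'I_l.+1) :
  i <= j -> g (f i) <= g (f j).
Proof. by move=> ij; do 2 apply: dfun_homo. Qed.

Definition dcomp l m n (g : dmap m n) (f : dmap l m) : dmap l n :=
  mk_dmap (dcomp_subproof g f).

Lemma coface_subproof n (i : 'I_n.+2) (j k : 'I_n.+1) :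
  j <= k -> lift i j <= lift i k.
Proof. by move=> jk; rewrite /= leq_bump2. Qed.

(** The injection [n] -> [n+1] that omits i. *)
Definition coface n (i : 'I_n.+2) : dmap n n.+1 := mk_dmap (coface_subproof i).

Lemma unbump_lt n (j : 'I_n.+1) (k : 'I_n.+2) : unbump j k < n.+1.
Proof.
rewrite /unbump; case: (ltnP j k) => [jk|kj] /=.
  by rewrite subn1; case: k jk => [[|k] kn].
by rewrite subn0 (leq_ltn_trans kj).
Qed.

Lemma codegen_subproof n (j : 'I_n.+1) (i k : 'I_n.+2) :
  i <= k -> Ordinal (unbump_lt j i) <= Ordinal (unbump_lt j k).
Proof.
rewrite /= /unbump => ik; case: (ltnP j i) => ji /=.
  by rewrite (leq_trans ji ik) leq_sub2r.
rewrite subn0; case: (ltnP j k) => jk /=; rewrite ?subn0 // subn1.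
by rewrite (leq_trans ji) // -ltnS (ltn_predK jk).
Qed.

(** The surjection [n+1] -> [n] that takes the value j twice. *)
Definition codegen n (j : 'I_n.+1) : dmap n.+1 n :=
  mk_dmap (@codegen_subproof n j).

End Delta.

(** Simplicial sets as contravariant functors on the simplex category, [sact f]
    being the action f^* of f. *)
Record sset := SSet {
  spx :> nat -> choiceType;
  sact : forall m n, dmap m n -> spx n -> spx m;
  sact_id : forall n (x : spx n), sact (did n) x = x;
  sact_comp : forall l m n (g : dmap m n) (f : dmap l m) (x : spx n),
    sact (dcomp g f) x = sact f (sact g x)
}.

Definition face (X : sset) n (i : 'I_n.+2) : X n.+1 -> X n := sact (coface i).

Definition degen (X : sset) n (j : 'I_n.+1) : X n -> X n.+1 := sact (codegen j).

Definition nondegenerate (X : sset) n : X n -> Prop :=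
  if n is m.+1 return X n -> Prop
  then fun x => forall (j : 'I_m.+1) (y : X m), x <> degen j y
  else fun _ => True.

Definition simplex (X : sset) := {n : nat & X n}.

Section Quotient.
Variables (X : sset) (r : forall n, equiv_rel (X n)).
Hypothesis r_act : forall m n (f : dmap m n) (x y : X n),
  r n x y -> r m (sact f x) (sact f y).
Local Open Scope quotient_scope.

Definition quot_act m n (f : dmap m n) (x : {eq_quot (r n)}) : {eq_quot (r m)} :=
  \pi_{eq_quot (r m)} (sact f (repr x)).

Lemma quot_actE m n (f : dmap m n) (x : X n) :
  quot_act f (\pi_{eq_quot (r n)} x) = \pi_{eq_quot (r m)} (sact f x).
Proof.
apply/eqmodP; apply: r_act; by apply/eqmodP; rewrite reprK.
Qed.

Lemma quot_act_id n (x : {eq_quot (r n)}) : quot_act (did n) x = x.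
Proof. by rewrite -[x]reprK quot_actE sact_id. Qed.

Lemma quot_act_comp l m n (g : dmap m n) (f : dmap l m) (x : {eq_quot (r n)}) :
  quot_act (dcomp g f) x = quot_act f (quot_act g x).
Proof.
rewrite -[x]reprK (quot_actE (dcomp g f)) (quot_actE g) (quot_actE f).
by rewrite sact_comp.
Qed.

Definition sset_quot : sset :=
  @SSet (fun n => {eq_quot (r n)}) quot_act quot_act_id quot_act_comp.

End Quotient.

Section Nerve.
Variables (gT : finGroupType) (C : {set {group gT}}).

(** Chains P_0 <= ... <= P_n, repetitions allowed; the simplicial structure is
    precomposition, so [coface] deletes and [codegen] repeats an entry. *)
Definition chain (n : nat) := {P : {ffun 'I_n.+1 -> {group gT}} |
  [forall i, P i \in C] &&
  [forall i : 'I_n.+1, forall j : 'I_n.+1, (i <= j) ==> (P i \subset P j)]}.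

Definition chain_fun n (x : chain n) : 'I_n.+1 -> {group gT} := val x.

Coercion chain_fun : chain >-> Funclass.

Lemma chain_mem n (x : chain n) i : x i \in C.
Proof. by have /andP[/forallP/(_ i)] := valP x. Qed.

Lemma chain_homo n (x : chain n) (i j : 'I_n.+1) : i <= j -> x i \subset x j.
Proof. by have /andP[_ /forallP/(_ i)/forallP/(_ j)/implyP] := valP x. Qed.

Lemma chain_act_subproof m n (f : dmap m n) (x : chain n) :
  [forall i, [ffun k => x (f k)] i \in C] &&
  [forall i : 'I_m.+1, forall j : 'I_m.+1,
    (i <= j) ==> ([ffun k => x (f k)] i \subset [ffun k => x (f k)] j)].
Proof.
apply/andP; split; first by apply/forallP => i; rewrite ffunE chain_mem.
by apply/forallP => i; apply/forallP => j; apply/implyP => ij; rewrite !ffunE chain_homo ?dfun_homo.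
Qed.

Definition chain_act m n (f : dmap m n) (x : chain n) : chain m :=
  Sub [ffun k => x (f k)] (chain_act_subproof f x).

Lemma chain_actE m n (f : dmap m n) (x : chain n) i : chain_act f x i = x (f i).
Proof. by rewrite /chain_fun /= ffunE. Qed.

Lemma chainP n (x y : chain n) : (forall i, x i = y i) -> x = y.
Proof. by move=> xy; apply/val_inj/ffunP. Qed.

Lemma chain_act_id n (x : chain n) : chain_act (did n) x = x.
Proof. by apply: chainP => i; rewrite chain_actE mk_dmapE. Qed.

Lemma chain_act_comp l m n (g : dmap m n) (f : dmap l m) (x : chain n) :
  chain_act (dcomp g f) x = chain_act f (chain_act g x).
Proof. by apply: chainP => i; rewrite !chain_actE mk_dmapE. Qed.

Definition nerve : sset :=
  @SSet (fun n => chain n : choiceType) chain_act chain_act_id chain_act_comp.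

End Nerve.

Section QuotientNerve.
Variables (gT : finGroupType) (S : {group gT}) (F : fusion_system S).
Variable C : fcollection F.

Definition chain_rel n : rel (chain C n) := fun P Q =>
  [exists phi, is_iso (fhom F) (P ord_max) (Q ord_max) phi &&
               [forall i, phi @: P i == Q i :> {set gT}]].

Let sub n (x : chain C n) i : x i \subset S.
Proof. exact: fcoll_sub (chain_mem x i). Qed.

Let sub_max n (x : chain C n) i : x i \subset x ord_max.
Proof. by apply: chain_homo; rewrite -ltnS. Qed.

Lemma chain_rel_refl n : reflexive (@chain_rel n).
Proof.
move=> x; apply/existsP; exists (incl (x ord_max)).
rewrite is_iso_refl ?sub //=; apply/forallP => i; apply/eqP.
rewrite -[RHS]imset_id; apply: eq_in_imset => a ax.
by rewrite restrE // (subsetP (sub_max x i)).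
Qed.

Lemma chain_rel_sym_imp n (x y : chain C n) : chain_rel x y -> chain_rel y x.
Proof.
case/existsP=> phi /andP[/existsP[psi hi] /forallP h].
apply/existsP; exists psi; apply/andP; split.
  by apply/existsP; exists phi; exact: inverse_isos_sym.
have [_ k _] := inverse_isosP (sub x _) (sub y _) hi.
apply/forallP => i; rewrite -(eqP (h i)) -imset_comp; apply/eqP.
rewrite -[RHS]imset_id; apply: eq_in_imset => a ax.
by rewrite /= k // (subsetP (sub_max x i)).
Qed.

Lemma chain_rel_sym n : symmetric (@chain_rel n).
Proof. by move=> x y; apply/idP/idP; exact: chain_rel_sym_imp. Qed.

Lemma chain_rel_trans n : transitive (@chain_rel n).
Proof.
move=> y x z /existsP[phi /andP[/existsP[phi' hi] /forallP h]].
case/existsP=> psi /andP[/existsP[psi' hi'] /forallP h'].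
apply/existsP; exists (hcomp psi phi); apply/andP; split.
  apply/existsP; exists (hcomp phi' psi').
  exact: inverse_isos_comp hi hi'; exact: sub.
apply/forallP => i; rewrite -(eqP (h' i)) -(eqP (h i)) -imset_comp; apply/eqP.
by apply: eq_in_imset => a _; rewrite ffunE.
Qed.

Canonical chain_equiv n :=
  EquivRel (@chain_rel n) (@chain_rel_refl n) (@chain_rel_sym n)
    (@chain_rel_trans n).

Lemma chain_rel_act m n (f : dmap m n) (x y : chain C n) :
  chain_equiv n x y -> chain_equiv m (chain_act f x) (chain_act f y).
Proof.
case/existsP=> phi /andP[hi /forallP h].
apply/existsP; exists (restr (chain_act f x ord_max) phi).
apply/andP; split; rewrite /= ?chain_actE.
  apply: is_iso_restr hi (eqP (h _)); rewrite ?sub ?sub_max //.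
apply/forallP => i; rewrite !chain_actE -(eqP (h (f i))); apply/eqP.
apply: eq_in_imset => a ax; rewrite restrE //.
by rewrite (subsetP (chain_homo x _)  _ ax) // dfun_homo // -ltnS.
Qed.

Definition quotient_nerve : sset :=
  @sset_quot (nerve C) chain_equiv chain_rel_act.

End QuotientNerve.

From Stdlib Require Import Relation_Operators.
From mathcomp Require Import all_classical reals topology normedtype.
Import numFieldNormedType.Exports.

Section Morse.
Local Open Scope classical_set_scope.

(** [mate] is the bijection c and [idx] is iota; only their values on redundant
    cells matter. *)
Record morse_data (X : sset) := MorseData {
  critical_cells : set (simplex X);
  redundant_cells : set (simplex X);
  collapsible_cells : set (simplex X);
  mate : forall n, X n -> X n.+1;
  idx : forall n, X n -> 'I_n.+2
}.

Variables (X : sset) (M : morse_data X).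

Definition cells : set (simplex X) := [set x | nondegenerate (tagged x)].

Definition mate_simplex (x : simplex X) : simplex X :=
  Tagged (spx X) (mate M (tagged x)).

Inductive morse_edge : simplex X -> simplex X -> Prop :=
| MatchEdge n (t : X n) :
    redundant_cells M (Tagged (spx X) t) ->
    morse_edge (Tagged (spx X) t) (Tagged (spx X) (mate M t))
| FaceEdge n (t : X n) (j : 'I_n.+2) :
    redundant_cells M (Tagged (spx X) t) -> j <> idx M t ->
    (redundant_cells M `|` collapsible_cells M)
      (Tagged (spx X) (face j (mate M t))) ->
    morse_edge (Tagged (spx X) (mate M t))
               (Tagged (spx X) (face j (mate M t))).

Definition morse_matching : Prop :=
  [/\ [/\ critical_cells M `|` redundant_cells M `|` collapsible_cells M = cells,
          critical_cells M `&` redundant_cells M = set0,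
          critical_cells M `&` collapsible_cells M = set0 &
          redundant_cells M `&` collapsible_cells M = set0],
      set_bij (redundant_cells M) (collapsible_cells M) mate_simplex,
      forall n (t : X n), redundant_cells M (Tagged (spx X) t) ->
        t = face (idx M t) (mate M t) &
      ~ exists path : nat -> simplex X,
          forall k, morse_edge (path k) (path k.+1)].

End Morse.

Section Realization.
Local Open Scope classical_set_scope.
Local Open Scope ring_scope.
Local Open Scope quotient_scope.
Variables (R : realType) (X : sset).

Definition std_simplex (n : nat) : set 'rV[R]_n.+1 :=
  [set t | (forall i, 0 <= t 0 i) /\ \sum_i t 0 i = 1].

Arguments std_simplex : clear implicits.

Lemma push_subproof m n (f : dmap m n) (t : std_simplex m) :
  (\row_j \sum_(i | f i == j) set_val t 0 i) \in std_simplex n.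
Proof.
have [t0 t1] := set_valP t.
apply/mem_set; split=> [j|]; first by rewrite mxE sumr_ge0.
under eq_bigr do rewrite mxE.
by rewrite -t1 [RHS](partition_big f xpredT).
Qed.

(** The affine map that f induces on standard simplices. *)
Definition push m n (f : dmap m n) (t : std_simplex m) : std_simplex n :=
  exist (fun v => v \in std_simplex n) _ (push_subproof f t).

(** The disjoint union over all simplices x of X of |Delta^(dim x)|. *)
Definition presentation := {x : simplex X & (std_simplex (tag x) : Type)}.

Definition ppoint n (x : X n) (t : std_simplex n) : presentation :=
  existT (fun y : simplex X => std_simplex (tag y) : Type) (Tagged (spx X) x) t.

Inductive glue : presentation -> presentation -> Prop :=
| Glue m n (f : dmap m n) (x : X n) (t : std_simplex m) :
    glue (ppoint (sact f x) t) (ppoint x (push f t)).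

Definition glue_rel (a b : presentation) : bool :=
  `[< clos_refl_sym_trans _ glue a b >].

Lemma glue_rel_refl : reflexive glue_rel.
Proof. by move=> a; apply/asboolP; exact: rst_refl. Qed.

Lemma glue_rel_sym : symmetric glue_rel.
Proof. by move=> a b; apply/asboolP/asboolP => ?; exact: rst_sym. Qed.

Lemma glue_rel_trans : transitive glue_rel.
Proof.
by move=> b a c /asboolP ab /asboolP bc; apply/asboolP; exact: rst_trans ab bc.
Qed.

Definition glue_equiv :=
  EquivRel glue_rel glue_rel_refl glue_rel_sym glue_rel_trans.

Definition realization := {eq_quot glue_equiv}.

HB.instance Definition _ :=
  Topological.copy realization (quotient_topology realization).
HB.instance Definition _ := Quotient.on realization.

End Realization.

Arguments std_simplex : clear implicits.

Section Contractible.
Local Open Scope classical_set_scope.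
Local Open Scope ring_scope.

Definition contractible (R : realType) (T : topologicalType) : Prop :=
  exists (a : T) (H : R * T -> T),
    [/\ {within `[0, 1] `*` [set: T], continuous H},
        forall x, H (0, x) = x & forall x, H (1, x) = a].

Definition sset_contractible (R : realType) (X : sset) : Prop :=
  contractible R (realization R X).

End Contractible.

(* Main.v *)
(** Let P_0 < ... < P_n be a strict chain, let i be the largest index such that
    P_i normalises P_0, ..., P_i, and put P_{n+1} = S. The group
    Q = N_{P_{i+1}}(P_0, ..., P_i) contains P_i. If Q > P_i the chain is redundant
    and its mate is obtained by inserting Q after P_i; if Q = P_i and i > 0 it is
    collapsible, and deleting P_i gives its mate because a proper subgroup of a
    p-group is smaller than its normaliser; if Q = P_i and i = 0 the chain is (S).
    For i < n this rule is compatible with isomorphisms in F. For i = n the group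
    Q = N_S(P_0, ..., P_n) depends on the representative of the class, which is
    chosen to be receptive: every isomorphism class of normal chains contains a chain
    P such that, for each isomorphic chain P', some isomorphism from P' to P extends
    to N_S(P'). It is found by moving P_n to a fully automized receptive subgroup
    and applying Sylow's theorem to the stabiliser of the chain in Aut_F(P_n).
    Along an edge from the mate of a redundant chain to another redundant chain of
    the same dimension, either i increases, or i stays and the sum of the orders of
    the P_k increases; so paths are finite.

    The vertices of a simplex of the orbit space are told apart by their orders, so a
    degenerate simplex determines the map by which it degenerates from a
    nondegenerate one, and maps out of the realization can be given cell by cell.
    Pushing each collapsible cell away from its redundant face, in the order of the
    weights above, contracts the realization to the critical vertex. *)

Require Import Defs.
From mathcomp Require Import all_boot all_order all_algebra.
From mathcomp Require Import all_fingroup all_solvable.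
From mathcomp Require Import lra zify.
From Stdlib Require Import Relation_Operators.
Import Order.TTheory GRing.Theory Num.Theory.
Set Implicit Arguments.
Unset Strict Implicit.
Unset Printing Implicit Defensive.

(** * Receptive chains *)

Section AutIn.
Local Open Scope group_scope.
Variables (gT : finGroupType) (S : {group gT}) (F : fusion_system S).

Lemma hcomp_restr_perm (Q : {group gT}) (a b : {perm gT}) :
  a \in Aut Q -> b \in Aut Q -> hcomp (restr Q b) (restr Q a) = restr Q (a * b).
Proof.
move=> Aa Ab; apply/ffunP => x; rewrite !ffunE permM.
case: (boolP (x \in Q)) => xQ; first by rewrite (Aut_closed Aa).
have b1 : b 1 = 1 by rewrite -(autmE Ab) morph1.
by rewrite group1.
Qed.

Lemma restr_perm1 (Q : {group gT}) : restr Q (1 : {perm gT}) = incl Q.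
Proof. by apply/ffunP => x; rewrite !ffunE perm1. Qed.

Lemma aut_in_group_set (Q : {group gT}) : Q \subset S ->
  group_set (aut_in (fhom F) Q).
Proof.
move=> sQ; apply/group_setP; split=> [|a b].
  by apply/setIdP; rewrite group1 restr_perm1 incl_fhom.
case/setIdP=> Aa Fa /setIdP[Ab Fb].
apply/setIdP; split; first exact: (@groupM _ (Aut_group Q)).
by rewrite -hcomp_restr_perm//; exact: fhom_comp Fa Fb.
Qed.

Lemma HomSP (P Q : {group gT}) phi : reflect
  (exists g, [/\ g \in S, P :^ g \subset Q & phi = conj_map P g])
  (phi \in HomS S P Q).
Proof.
apply: (iffP imsetP) => [[g]|[g [gS gQ ->]]].
  by rewrite inE => /andP[gS gQ] ->; exists g.
by exists g; rewrite // inE gS.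
Qed.

Lemma aut_inS_group_set (Q : {group gT}) : group_set (aut_in (HomS S) Q).
Proof.
apply/group_setP; split=> [|a b].
  apply/setIdP; rewrite group1 restr_perm1; split=> //.
  apply/HomSP; exists 1; rewrite group1 conjsg1; split=> //.
  by apply/ffunP => x; rewrite !ffunE conjg1.
case/setIdP=> Aa /HomSP[g [gS gQ ea]] /setIdP[Ab /HomSP[h [hS hQ eb]]].
apply/setIdP; split; first exact: (@groupM _ (Aut_group Q)).
rewrite -hcomp_restr_perm// ea eb; apply/HomSP; exists (g * h).
rewrite groupM// conjsgM; split=> //; first by apply: subset_trans hQ; rewrite conjSg.
apply/ffunP => x; rewrite !ffunE; have [xQ|xQ] := boolP (x \in Q);
  last by rewrite group1 conj1g.
by rewrite (subsetP gQ) ?memJ_conjg// conjgM.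
Qed.

(** [aut_in] is a finite set closed under products, hence a group, so the inverse of [a] also lies
    in F. *)
Lemma restr_perm_iso (Q : {group gT}) (a : {perm gT}) : Q \subset S ->
  a \in aut_in (fhom F) Q ->
  inverse_isos (fhom F) Q Q (restr Q a) (restr Q a^-1).
Proof.
move=> sQ aA; have := aA; have: a^-1 \in Group (aut_in_group_set sQ).
  by rewrite groupV.
case/setIdP=> AV FV /setIdP[Aa Fa].
by rewrite /inverse_isos Fa FV !hcomp_restr_perm// mulgV mulVg restr_perm1 eqxx.
Qed.

Lemma imset_group_set (Q H : {group gT}) (phi : gT -> gT) : H \subset Q ->
  {in Q &, {morph phi : x y / x * y}} -> group_set (phi @: H).
Proof.
move=> /subsetP sHQ hm; apply/group_setP; split=> [|_ _ /imsetP[x xH ->]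
  /imsetP[y yH ->]].
  apply/imsetP; exists 1; rewrite ?group1//.
  by apply: (mulgI (phi 1)); rewrite -hm ?group1 // !mulg1.
by rewrite -hm ?sHQ// imset_f// groupM.
Qed.

End AutIn.

(** * Transport of chains along isomorphisms, and receptive representatives *)

Section Chains.
Local Open Scope group_scope.
Variables (gT : finGroupType) (S : {group gT}) (F : fusion_system S).
Variable C : fcollection F.

Lemma fcoll_iso (P Q : {group gT}) phi : Q \subset S -> P \in fcoll C ->
  Defs.is_iso (fhom F) P Q phi -> Q \in fcoll C.
Proof.
case: C => /= D [A sA ->] sQ /bigcupP[B BA /[!inE] /andP[sP /existsP[psi /existsP[psi'
  ib]]]] /existsP[phi' ip].
apply/bigcupP; exists B => //; rewrite inE sQ; apply/existsP; exists (hcomp phi psi).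
have sB : B \subset S by have := subsetP sA _ BA; rewrite inE.
by apply/existsP; exists (hcomp psi' phi'); exact: inverse_isos_comp ib ip.
Qed.

Lemma chain_sub n (x : chain C n) i : x i \subset S.
Proof. exact: fcoll_sub (chain_mem x i). Qed.

Lemma chain_sub_max n (x : chain C n) i : x i \subset x ord_max.
Proof. by apply: chain_homo; rewrite -ltnS. Qed.

(** An isomorphism in F restricts to isomorphisms onto the images of subgroups, so the images of the
    entries stay in the collection. *)
Lemma transport_chain n (x : chain C n) (Q : {group gT}) phi phi' : Q \subset S ->
  inverse_isos (fhom F) (x ord_max) Q phi phi' ->
  exists y : chain C n, y ord_max = Q /\ forall i, phi @: x i = y i.
Proof.
move=> sQ ip; have sx := chain_sub x ord_max.
have hp : phi \in fhom F (x ord_max) Q by case/and4P: ip.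
have [hm _ hs _] := fhomP sx sQ hp.
pose y i := Group (imset_group_set (chain_sub_max x i) hm).
have sy i : y i \subset Q.
  by apply: subset_trans hs; apply: imsetS; exact: chain_sub_max.
have yP : [forall i, finfun y i \in fcoll C] &&
    [forall i : 'I_n.+1, forall j : 'I_n.+1, (i <= j) ==>
      (finfun y i \subset finfun y j)].
  apply/andP; split; apply/forallP => i; last first.
    by apply/forallP => j; apply/implyP => ij; rewrite !ffunE imsetS// chain_homo.
  rewrite ffunE; apply: (fcoll_iso _ (chain_mem x i)); first exact: subset_trans sQ.
  apply: (is_iso_restr sx sQ (chain_sub_max x i) (sy i)) => //.
  by apply/existsP; exists phi'.
exists (Sub (finfun y) yP : chain C n).
have yE i : (Sub (finfun y) yP : chain C n) i = y i by rewrite /chain_fun /= ffunE.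
split=> [|i]; last by rewrite yE.
rewrite yE; apply: val_inj => /=.
by have [] := inverse_isosP sx sQ ip.
Qed.

Definition chain_norm n (x : chain C n) : {group gT} := (S :&: \bigcap_i 'N(x i))%G.

Lemma chain_norm_sub n (x : chain C n) : chain_norm x \subset S.
Proof. exact: subsetIl. Qed.

Lemma mem_chain_norm n (x : chain C n) g :
  g \in chain_norm x -> forall i, x i :^ g = x i.
Proof. by case/setIP => _ /bigcapP h i; apply/normP; exact: h. Qed.

(** The chain analogue of a receptive subgroup; the assumption on [y ord_max] says
    that the chain is normal. *)
Definition receptive_chain n (x : chain C n) := forall y : chain C n,
  chain_rel y x -> y ord_max \subset chain_norm y ->
  exists2 psi, psi \in fhom F (chain_norm y) S & forall i, psi @: y i = x i.

Section Conjugation.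
Variables (n : nat) (y : chain C n) (Q : {group gT}) (phi psi : {ffun gT -> gT}).
Hypotheses (sQ : Q \subset S) (ip : inverse_isos (fhom F) (y ord_max) Q phi psi).
Local Notation P := (y ord_max).

Let sP : P \subset S. Proof. exact: chain_sub. Qed.

Lemma chain_norm_conj : exists f : gT -> {perm gT}, forall g, g \in chain_norm y ->
  [/\ f g \in aut_in (fhom F) Q, {in Q, forall x, f g x = phi (psi x ^ g)} &
      forall i, f g @: (phi @: y i) = phi @: y i].
Proof.
apply: (@fin_all_exists _ (fun=> {perm gT}) (fun g a => g \in chain_norm y ->
  [/\ a \in aut_in (fhom F) Q, {in Q, forall x, a x = phi (psi x ^ g)} &
      forall i, a @: (phi @: y i) = phi @: y i])) => g.
have [gN|gN] := boolP (g \in chain_norm y); last by exists 1.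
have [eP k1 k2] := inverse_isosP sP sQ ip.
have [hp hq _ _] := and4P ip.
have [mp jp sp _] := fhomP sP sQ hp; have [mq jq sq _] := fhomP sQ sP hq.
have gP : P :^ g = P by exact: mem_chain_norm gN _.
have psiQ x : x \in Q -> psi x \in P by move=> xQ; rewrite (subsetP sq)// imset_f.
have phiP x : x \in P -> phi x \in Q by move=> xQ; rewrite (subsetP sp)// imset_f.
have psiJ x : x \in Q -> psi x ^ g \in P by move=> xQ; rewrite -gP memJ_conjg psiQ.
(* Elements of [Aut Q] are permutations of the whole ambient group that fix every point outside
   Q. *)
pose u x := if x \in Q then phi (psi x ^ g) else x.
have uQ x : (u x \in Q) = (x \in Q).
  by rewrite /u; case: ifP => // xQ; rewrite phiP ?psiJ.
have ui : injective u.
  move=> x x' e; have := congr1 (fun z => z \in Q) e; rewrite !uQ.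
  move: e; rewrite /u; case: ifP => xQ; case: ifP => // x'Q e _.
  by apply: jq => //; apply: (conjg_inj g); apply: jp e; rewrite ?psiJ.
have aA : perm ui \in Aut Q.
  rewrite inE; apply/andP; split.
    by apply/subsetP => x; rewrite inE permE; apply: contraR => xQ; rewrite /u (negPf xQ).
  apply/morphicP => x x' xQ x'Q; rewrite !permE /u groupM// xQ x'Q mq// conjMg.
  by rewrite mp ?psiJ.
exists (perm ui) => _; split=> [|x xQ|i]; last 2 first.
- by rewrite permE /u xQ.
- apply/eqP; rewrite eqEcard [#|_ @: (_ @: _)|]card_imset ?leqnn ?andbT;
  last exact: perm_inj.
  apply/subsetP => _ /imsetP[_ /imsetP[x xi ->] ->].
  have xP : x \in P by exact: subsetP (chain_sub_max y i) x xi.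
  rewrite permE /u phiP// k1// imset_f//.
  by rewrite -(mem_chain_norm gN i) memJ_conjg.
apply/setIdP; split=> //.
have -> : restr Q (perm ui) = hcomp phi (hcomp (conj_map P g) psi).
  apply/ffunP => x; rewrite !ffunE permE /u; case: (boolP (x \in Q)) => xQ.
    by rewrite psiQ.
  have [_ _ _ q1] := fhomP sQ sP hq; rewrite q1// group1 conj1g.
  by apply/esym; apply: (mulgI (phi 1)); rewrite -mp ?group1 // !mulg1.
apply: (fhom_comp (Q := P)) => //; apply: (fhom_comp (Q := P)) => //.
apply: (subsetP (fhom_HomS F sP sP)); apply/HomSP; exists g.
by rewrite gP subxx; case/setIP: gN.
Qed.

End Conjugation.

Definition chain_stab n (y : chain C n) Q : {set {perm gT}} :=
  [set a in aut_in (fhom F) Q | [forall i, a @: y i == y i :> {set gT}]].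

Lemma chain_stabP n (y : chain C n) (Q : {group gT}) a : reflect
  (a \in aut_in (fhom F) Q /\ forall i, a @: y i = y i) (a \in chain_stab y Q).
Proof.
apply: (iffP setIdP) => -[aA h]; split=> //.
  by move=> i; apply/eqP; exact: (forallP h).
by apply/forallP => i; apply/eqP.
Qed.

Lemma imset_permM (a b : {perm gT}) (A : {set gT}) : (a * b) @: A = b @: (a @: A).
Proof. by rewrite -imset_comp; apply: eq_imset => x /=; rewrite permM. Qed.

Lemma imset_perm1 (A : {set gT}) : (1 : {perm gT}) @: A = A.
Proof. by rewrite -[RHS]imset_id; apply: eq_imset => x; rewrite perm1. Qed.

Lemma chain_stab_group_set n (y : chain C n) (Q : {group gT}) : Q \subset S ->
  group_set (chain_stab y Q).
Proof.
move=> sQ; have gA := aut_in_group_set F sQ.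
apply/group_setP; split=> [|a b].
  apply/chain_stabP; split=> [|i]; first exact: (@group1 _ (Group gA)).
  exact: imset_perm1.
move=> /chain_stabP[aA ha] /chain_stabP[bA hb]; apply/chain_stabP; split=> [|i].
  exact: (@groupM _ (Group gA)).
by rewrite imset_permM ha hb.
Qed.

(** The chain is moved so that Aut_S(Q) contains a Sylow p-subgroup of its stabiliser K in Aut_F(Q).
    For an isomorphic chain [z], the automorphisms that N_S(z) induces on Q can then be conjugated
    into Aut_S(Q) within K, and receptivity of Q extends the isomorphism so corrected. *)
Lemma exists_receptive_chain (p : nat) n (x : chain C n) : p.-group S -> saturated F p ->
  exists2 y, chain_rel x y & receptive_chain y.
Proof.
move=> pS satF; have [Q [sQ /existsP[al /existsP[al' ial]] fQ rQ]] :=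
  satF _ (chain_sub x ord_max).
have [y0 [y0Q y0E]] := transport_chain sQ ial.
pose AF := Group (aut_in_group_set F sQ); pose AS := Group (aut_inS_group_set S Q).
pose K0 := Group (chain_stab_group_set y0 sQ).
(* Since Q is fully automized, Aut_S(Q) is Sylow in Aut_F(Q), so some [a] conjugates U into it.
   Moving [y0] by [a] replaces its stabiliser K0 by the conjugate K. *)
have [U sylU] := Sylow_exists p K0.
have [a aAF UaS] : exists2 a, a \in AF & U :^ a \subset AS.
  apply: Sylow_Jsub (pHall_pgroup sylU) => //.
  by apply: subset_trans (pHall_sub sylU) _; apply/subsetP => b /chain_stabP[].
have ia : inverse_isos (fhom F) (y0 ord_max) Q (restr Q a) (restr Q a^-1).
  by rewrite y0Q; exact: restr_perm_iso.
have [y [yQ yE]] := transport_chain sQ ia.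
have y0subQ i : y0 i \subset Q by rewrite -y0Q; exact: chain_sub_max.
have {}yE i : a @: y0 i = y i.
  by rewrite -yE; apply: eq_in_imset => u ui; rewrite restrE// (subsetP (y0subQ i)).
have y0V i : a^-1 @: y i = y0 i.
  by rewrite -yE -imset_permM mulgV imset_perm1.
pose K := Group (chain_stab_group_set y sQ).
have KE : K :=: K0 :^ a.
  apply/setP => b; rewrite mem_conjg conjgE invgK.
  have AE : (a * (b * a^-1) \in AF) = (b \in AF) by rewrite groupMl// groupMr// groupV.
  apply/chain_stabP/chain_stabP => -[bA hb]; split=> [|i].
  - by rewrite -[_ \in _]/(_ \in AF) AE.
  - by rewrite !imset_permM yE hb y0V.
  - by rewrite -[_ \in _]/(_ \in AF) -AE.
  - have := hb i => /(congr1 (fun A : {set gT} => a @: A)).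
    by rewrite !imset_permM yE -[a @: (a^-1 @: _)]imset_permM mulVg imset_perm1.
have sylUa : p.-Sylow(K) (U :^ a) by rewrite KE pHallJ2.
exists y.
  apply/existsP; exists (hcomp (restr Q a) al); apply/andP; split.
    apply/existsP; exists (hcomp al' (restr Q a^-1)); rewrite yQ.
    rewrite y0Q in ia; apply: inverse_isos_comp ial ia => //; exact: chain_sub.
  apply/forallP => i; rewrite -yE -y0E -imset_comp; apply/eqP.
  apply: eq_in_imset => u ui /=; rewrite ffunE restrE//.
  by rewrite (subsetP (y0subQ i))// -y0E imset_f.
move=> z /existsP[phi /andP[/existsP[psi ip] /forallP hphi]] sz.
rewrite yQ in ip; have {}hphi i : phi @: z i = y i by apply/eqP.
have [f fP] := chain_norm_conj sQ ip.
pose N := chain_norm z.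
have fA g : g \in N -> f g \in Aut Q by move=> /fP[/setIdP[]].
have [eP k1 k2] := inverse_isosP (chain_sub z _) sQ ip.
have [eQ _ _] := inverse_isosP sQ (chain_sub z _) (inverse_isos_sym ip).
have psiQ u : u \in Q -> psi u \in z ord_max by move=> uQ; rewrite -eQ imset_f.
have zJ g u : g \in N -> u \in z ord_max -> u ^ g \in z ord_max.
  by move=> gN uz; rewrite -[X in _ \in gval X]/(z ord_max) -(mem_chain_norm gN ord_max)
    memJ_conjg.
have fM : {in N &, {morph f : g h / g * h}}.
  move=> g h gN hN; apply: (@eq_Aut _ Q); first exact/fA/groupM.
    by apply: (@groupM _ (Aut_group Q)); exact: fA.
  move=> u uQ; have [_ -> // _] := fP _ (groupM gN hN).
  have [_ fg _] := fP _ gN; have [_ fh _] := fP _ hN.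
  rewrite permM fg// fh ?k1 ?conjgM// ?zJ ?psiQ//.
  by rewrite -eP imset_f// zJ ?psiQ.
pose fm := Morphism fM.
have fK : fm @* N \subset K.
  apply/subsetP => _ /morphimP[g _ gN ->]; apply/chain_stabP.
  by have [fgA _ fst] := fP _ gN; split=> // i; rewrite -hphi fst.
have pf : p.-group (fm @* N).
  by apply: morphim_pgroup; apply: pgroupS pS; exact: chain_norm_sub.
(* The automorphisms induced by N form a p-subgroup of K, and [b] conjugates them into Aut_S(Q). The
   corrected isomorphism is [phi] followed by [b]. *)
have [b bK fbU] := Sylow_Jsub sylUa fK pf.
have [bA hb] := chain_stabP _ _ _ bK.
have fbS g : g \in N -> f g ^ b \in AS.
  move=> gN; apply: (subsetP UaS); apply: (subsetP fbU); rewrite memJ_conjg.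
  exact: (mem_morphim fm).
have ib := restr_perm_iso sQ bA.
have ip' := inverse_isos_comp (chain_sub z _) sQ sQ ip ib.
have [phib phibF phibE] := rQ _ _ _ (chain_sub z _) ip'.
have one_of (A B : {group gT}) h h' : A \subset S -> B \subset S ->
    inverse_isos (fhom F) A B h h' -> h 1 = 1.
  move=> sA sB /and4P[hh _ _ _]; have [hm _ _ _] := fhomP sA sB hh.
  by apply: (mulgI (h 1)); rewrite -hm ?group1// !mulg1.
have phi1 : phi 1 = 1 by apply: one_of ip => //; exact: chain_sub.
have psi1 : psi 1 = 1 by apply: one_of (inverse_isos_sym ip) => //; exact: chain_sub.
have bQ u : u \in Q -> b u \in Q by apply: Aut_closed; case/setIdP: bA.
have bVQ u : u \in Q -> b^-1 u \in Q.
  apply: Aut_closed; rewrite -[_ \in _]/(_ \in Aut_group Q) groupV.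
  by case/setIdP: bA.
(* The corrected isomorphism transports conjugation by g to [f g ^ b], which is induced by an
   element of S. *)
have NN : N \subset Nphi S (z ord_max) Q (hcomp (restr Q b) phi) (hcomp psi (restr Q
  b^-1)).
  apply/subsetP => g gN; apply/setIdP; split.
    apply/setIP; split; first exact: subsetP (chain_norm_sub z) g gN.
    by case/setIP: gN => _ /bigcapP; apply.
  have /setIdP[_] := fbS g gN; congr (_ \in HomS S Q Q).
  apply/ffunP => u; rewrite !ffunE; have [uQ|uQ] := boolP (u \in Q).
    have [_ fg _] := fP _ gN.
    rewrite conjgE !permM fg ?bVQ// psiQ ?bVQ//.
    by rewrite (_ : phi _ \in Q)// -eP imset_f// zJ// psiQ// bVQ.
  rewrite psi1 group1 conj1g phi1 group1.
  by have /setIdP[Ab _] := bA; rewrite -(autmE Ab) morph1.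
have sNphi : <<Nphi S (z ord_max) Q (hcomp (restr Q b) phi) (hcomp psi (restr Q b^-1))>>
  \subset S.
  by rewrite gen_subG; apply/subsetP => g /setIdP[/setIP[]].
exists (hcomp phib (incl N)) => [|i].
  apply: (fhom_comp (Q := <<Nphi S (z ord_max) Q (hcomp (restr Q b) phi) (hcomp psi
    (restr Q b^-1))>>%G)) => //.
  - exact: chain_norm_sub.
  - by apply: incl_fhom => //; apply: subset_trans (subset_gen _).
(* As [b] stabilises [y], the correction does not change the image of [z]. *)
rewrite -hb -hphi -imset_comp; apply: eq_in_imset => u ui /=.
have uz : u \in z ord_max by exact: subsetP (chain_sub_max z i) u ui.
rewrite !ffunE (subsetP sz)//; move/ffunP: phibE => /(_ u).
by rewrite !ffunE uz => ->; rewrite (_ : phi u \in Q)// -eP imset_f.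
Qed.

End Chains.

(** * Insertion of normalisers *)

Section Classes.
Local Open Scope group_scope.
Variables (gT : finGroupType) (S : {group gT}) (F : fusion_system S).
Variable C : fcollection F.

Definition chain_class n (P : chain C n) : quotient_nerve C n :=
  (\pi_{eq_quot (@chain_equiv gT S F C n)} P)%qT.

Lemma chain_class_eq n (P Q : chain C n) : chain_rel P Q -> chain_class P = chain_class Q.
Proof. by move=> PQ; apply/eqmodP. Qed.

Lemma chain_class_rel n (P Q : chain C n) : chain_class P = chain_class Q ->
  chain_rel P Q.
Proof. by move=> /eqmodP. Qed.

Lemma chain_class_surj n (x : quotient_nerve C n) : exists P : chain C n,
  x = chain_class P.
Proof. by exists (generic_quotient.repr x); rewrite /chain_class reprK. Qed.

Lemma chain_class_act m n (f : dmap m n) (P : chain C n) :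
  sact f (chain_class P) = chain_class (chain_act f P).
Proof.
exact: (@quot_actE (nerve C) (@chain_equiv gT S F C) (@chain_rel_act gT S F C) m n f P).
Qed.


Lemma chain_relP n (P Q : chain C n) : chain_rel P Q -> exists phi : {ffun gT -> gT},
  [/\ Defs.is_iso (fhom F) (P ord_max) (Q ord_max) phi, forall i, phi @: P i = Q i,
      {in P ord_max &, {morph phi : x y / x * y}} &
      {in P ord_max &, injective phi}].
Proof.
case/existsP=> phi /andP[iphi /forallP h]; exists phi.
have /existsP[psi /and4P[hp _ _ _]] := iphi.
have [hm hi _ _] := fhomP (chain_sub _ _) (chain_sub _ _) hp.
by split=> // i; exact/eqP.
Qed.

Lemma morph_conj (A : {group gT}) (phi : gT -> gT) : {in A &,
  {morph phi : x y / x * y}} ->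
  {in A &, forall x y, phi (x ^ y) = phi x ^ phi y}.
Proof.
move=> hm x y xA yA; apply: (mulgI (phi y)).
by rewrite -hm ?groupJ// -conjgC hm// -conjgC.
Qed.

Lemma chain_rel_card n (P Q : chain C n) i : chain_rel P Q -> #|P i| = #|Q i|.
Proof.
case/chain_relP=> phi [_ <- _ hi]; rewrite card_in_imset//.
by move=> u v ui vi; apply: hi; exact: subsetP (chain_sub_max P i) _ _.
Qed.

Definition normal_upto n (P : chain C n) (k : 'I_n.+1) : bool :=
  [forall i : 'I_n.+1, (i <= k) ==> (P k \subset 'N(P i))].

Lemma normal_uptoP n (P : chain C n) (k : 'I_n.+1) :
  reflect (forall i : 'I_n.+1, i <= k -> P k \subset 'N(P i)) (normal_upto P k).
Proof. by apply: (iffP forallP) => h i; [move/implyP: (h i)|apply/implyP; exact: h]. Qed.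

Lemma normal_upto0 n (P : chain C n) : normal_upto P ord0.
Proof.
apply/normal_uptoP => i; rewrite leqn0 => /eqP i0.
by rewrite (_ : i = ord0) ?normG//; exact: val_inj.
Qed.

Lemma normal_upto_leq n (P : chain C n) (k l : 'I_n.+1) :
  l <= k -> normal_upto P k -> normal_upto P l.
Proof.
move=> lk /normal_uptoP h; apply/normal_uptoP => i il.
by apply: subset_trans (h i (leq_trans il lk)); exact: chain_homo.
Qed.

Lemma normal_upto_rel n (P Q : chain C n) (k : 'I_n.+1) : chain_rel P Q ->
  normal_upto P k = normal_upto Q k.
Proof.
suff H (P' Q' : chain C n) : chain_rel P' Q' -> normal_upto P' k -> normal_upto Q' k.
  by move=> PQ; apply/idP/idP; apply: H => //; rewrite chain_rel_sym.
case/chain_relP=> phi [_ phiE hm _] /normal_uptoP h; apply/normal_uptoP => i ik.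
have mx j := subsetP (chain_sub_max P' j).
apply/subsetP => y; rewrite -phiE => /imsetP[u uk ->]; rewrite inE -phiE.
apply/subsetP => _ /imsetP[_ /imsetP[t ti ->] ->].
rewrite -(morph_conj hm); [|exact: mx ti|exact: mx uk].
by apply: imset_f; rewrite memJ_norm// (subsetP (h i ik)).
Qed.

Definition normal_index n (P : chain C n) : 'I_n.+1 := [arg max_(k > ord0 | normal_upto P
  k) k].

Lemma normal_indexP n (P : chain C n) : normal_upto P (normal_index P).
Proof. by rewrite /normal_index; case: arg_maxnP => //; exact: normal_upto0. Qed.

(** Normality passes to smaller indices, so the largest index is an exact threshold. *)
Lemma leq_normal_index n (P : chain C n) (k : 'I_n.+1) : (k <= normal_index P) =
  normal_upto P k.
Proof.
apply/idP/idP => [kP|]; first exact: normal_upto_leq kP (normal_indexP P).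
by rewrite /normal_index; case: arg_maxnP => [|i _]; [exact: normal_upto0|apply].
Qed.

Lemma normal_index_rel n (P Q : chain C n) : chain_rel P Q ->
  normal_index P = normal_index Q.
Proof.
move=> PQ; apply/val_inj/eqP; rewrite eqn_leq !leq_normal_index.
by rewrite -(normal_upto_rel _ PQ) normal_indexP (normal_upto_rel _ PQ) normal_indexP.
Qed.

(** The group [S] plays the role of [P_{n+1}]. *)
Definition next_group n (P : chain C n) : {group gT} :=
  if normal_index P < n then P (inord (normal_index P).+1) else S.

Definition new_group n (P : chain C n) : {group gT} :=
  (next_group P :&: \bigcap_(j : 'I_n.+1 | j <= normal_index P) 'N(P j))%G.

Lemma mem_new_group n (P : chain C n) g : reflect
  (g \in next_group P /\ forall j : 'I_n.+1, j <= normal_index P -> g \in 'N(P j))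
  (g \in new_group P).
Proof.
apply: (iffP setIP) => -[gU h]; split=> //; first by move=> j ji; exact: (bigcapP h).
exact/bigcapP.
Qed.

Lemma next_group_sub n (P : chain C n) : next_group P \subset S.
Proof. by rewrite /next_group; case: ifP => // _; exact: chain_sub. Qed.

Lemma new_group_sub n (P : chain C n) : new_group P \subset S.
Proof. apply: subset_trans (next_group_sub P); exact: subsetIl. Qed.

Lemma sub_new_group n (P : chain C n) : P (normal_index P) \subset new_group P.
Proof.
apply/subsetP => g gP; apply/mem_new_group; split=> [|j ji].
  rewrite /next_group; case: ifPn => iP; last exact: subsetP (chain_sub _ _) g gP.
  by apply: subsetP g gP; apply: chain_homo; rewrite inordK.
by move/normal_uptoP: (normal_indexP P) => /(_ j ji)/subsetP; apply.
Qed.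

Lemma new_group_max n (P : chain C n) : normal_index P = ord_max ->
  new_group P = chain_norm P.
Proof.
move=> iP; apply: val_inj; rewrite /= /next_group iP ltnn; congr (_ :&: _).
by apply: eq_bigl => j; rewrite -ltnS ltn_ord.
Qed.

(** For i < n the new group lies inside the top of the chain, where [phi] is defined and carries
    normalisers into normalisers. The same inclusion for an isomorphism in the other direction makes
    the orders equal. *)
Lemma new_group_rel n (P Q : chain C n) phi : normal_index P < n ->
  (forall i, phi @: P i = Q i) -> chain_rel P Q ->
  {in P ord_max &, {morph phi : x y / x * y}} -> {in P ord_max &, injective phi} ->
  phi @: new_group P = new_group Q.
Proof.
have H (P' Q' : chain C n) (phi' : gT -> gT) : normal_index P' < n ->
    (forall i, phi' @: P' i = Q' i) -> chain_rel P' Q' ->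
    {in P' ord_max &, {morph phi' : x y / x * y}} -> phi' @: new_group P' \subset
      new_group Q'.
  move=> iP phiE PQ hm; have mx j := subsetP (chain_sub_max P' j).
  apply/subsetP => _ /imsetP[u /mem_new_group[uU uN] ->].
  have {}uU : u \in P' (inord (normal_index P').+1) by move: uU; rewrite /next_group iP.
  apply/mem_new_group; rewrite -(normal_index_rel PQ) /next_group -(normal_index_rel PQ)
    iP.
  split=> [|j ji]; first by rewrite -phiE imset_f.
  rewrite inE -phiE; apply/subsetP => _ /imsetP[_ /imsetP[t tj ->] ->].
  rewrite -(morph_conj hm); [|exact: mx tj|exact: mx uU].
  by apply: imset_f; rewrite memJ_norm// uN.
move=> iP phiE PQ hm hi; apply/eqP; rewrite eqEcard H//=.
have QP : chain_rel Q P by rewrite chain_rel_sym.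
have [psi [_ psiE qm qi]] := chain_relP QP.
have mx (P' : chain C n) : normal_index P' < n -> {subset new_group P' <= P' ord_max}.
  move=> iP' g /mem_new_group[]; rewrite /next_group iP' => gU _.
  exact: subsetP (chain_sub_max _ _) g gU.
have iQ : normal_index Q < n by rewrite -(normal_index_rel PQ).
rewrite card_in_imset => [|u v /(mx P iP) uP /(mx P iP) vP]; last exact: hi.
rewrite -(@card_in_imset _ _ psi) => [|u v /(mx Q iQ) uP /(mx Q iQ) vP]; last exact: qi.
by apply: subset_leq_card; exact: H.
Qed.

(** The position i + 1 of the new group in the longer chain; [lift ord0] is the successor. *)
Definition pivot n (P : chain C n) : 'I_n.+2 := lift ord0 (normal_index P).

Definition insert_fun n (P : chain C n) (k : 'I_n.+2) : {group gT} :=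
  if unlift (pivot P) k is Some k' then P k' else new_group P.

Lemma insert_fun_lift n (P : chain C n) k : insert_fun P (lift (pivot P) k) = P k.
Proof. by rewrite /insert_fun liftK. Qed.

Lemma insert_fun_pivot n (P : chain C n) : insert_fun P (pivot P) = new_group P.
Proof. by rewrite /insert_fun unlift_none. Qed.

Lemma sub_lift_pivot n (P : chain C n) (k : 'I_n.+1) :
  lift (pivot P) k <= pivot P -> k <= normal_index P.
Proof. by rewrite /= /bump /=; lia. Qed.

Lemma new_group_sub_lift n (P : chain C n) (k : 'I_n.+1) :
  pivot P <= lift (pivot P) k -> new_group P \subset P k.
Proof.
move=> ck; have ik : normal_index P < k by move: ck; rewrite /= /bump /=; lia.
apply/subsetP => g /mem_new_group[+ _]; rewrite /next_group.
have iP : normal_index P < n by apply: leq_trans ik _; rewrite -ltnS.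
by rewrite iP; apply: subsetP; apply: chain_homo; rewrite inordK.
Qed.

Hypothesis closedC : fclosed_coll C.

Lemma insert_subproof n (P : chain C n) :
  [forall i, finfun (insert_fun P) i \in fcoll C] &&
  [forall i : 'I_n.+2, forall j : 'I_n.+2,
    (i <= j) ==> (finfun (insert_fun P) i \subset finfun (insert_fun P) j)].
Proof.
apply/andP; split; apply/forallP => i.
  rewrite ffunE; case: (unliftP (pivot P) i) => [k|] ->.
    by rewrite insert_fun_lift chain_mem.
  rewrite insert_fun_pivot; apply: closedC (chain_mem P (normal_index P)) _ _.
    exact: sub_new_group.
  exact: new_group_sub.
apply/forallP => j; apply/implyP; rewrite !ffunE.
case: (unliftP (pivot P) i) => [k|] ->; case: (unliftP (pivot P) j) => [l|] ->;
  rewrite ?insert_fun_lift ?insert_fun_pivot => ij //.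
- by apply: chain_homo; rewrite -(leq_bump2 (pivot P)).
- apply: subset_trans (sub_new_group P); apply: chain_homo; exact: sub_lift_pivot.
- exact: new_group_sub_lift.
Qed.

Definition insert n (P : chain C n) : chain C n.+1 := Sub (finfun (insert_fun P))
  (insert_subproof P).

Lemma insertE n (P : chain C n) k : insert P k = insert_fun P k.
Proof. by rewrite /chain_fun /= ffunE. Qed.

Lemma insert_lift n (P : chain C n) k : insert P (lift (pivot P) k) = P k.
Proof. by rewrite insertE insert_fun_lift. Qed.

Lemma insert_pivot n (P : chain C n) : insert P (pivot P) = new_group P.
Proof. by rewrite insertE insert_fun_pivot. Qed.

Lemma face_insert n (P : chain C n) : chain_act (coface (pivot P)) (insert P) = P.
Proof. by apply: chainP => i; rewrite chain_actE mk_dmapE insert_lift. Qed.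

Lemma insert_max n (P : chain C n) : normal_index P < n -> insert P ord_max = P ord_max.
Proof.
move=> iP; rewrite -(insert_lift P ord_max); congr (insert P _); apply: val_inj => /=.
by move: iP; rewrite /bump /=; lia.
Qed.

Lemma insert_rel n (P Q : chain C n) : normal_index P < n ->
  chain_rel P Q -> chain_rel (insert P) (insert Q).
Proof.
move=> iP PQ; have [phi [iphi phiE hm hi]] := chain_relP PQ.
apply/existsP; exists phi; rewrite !insert_max -?(normal_index_rel PQ)// iphi /=.
apply/forallP => i; apply/eqP.
have ePQ : pivot Q = pivot P by rewrite /pivot (normal_index_rel PQ).
case: (unliftP (pivot P) i) => [k|] ->; first by rewrite insert_lift phiE -ePQ
  insert_lift.
by rewrite insert_pivot (new_group_rel iP phiE PQ hm hi) -ePQ insert_pivot.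
Qed.

Lemma insert_normal_upto n (P : chain C n) : normal_upto (insert P) (pivot P).
Proof.
apply/normal_uptoP => i; case: (unliftP (pivot P) i) => [k|] -> ki; last exact: normG.
rewrite insert_pivot insert_lift; apply/subsetP => g /mem_new_group[_]; apply.
exact: sub_lift_pivot.
Qed.

Section Strict.
Variables (n : nat) (P : chain C n).
Hypothesis strictP : forall i j : 'I_n.+1, i < j -> #|P i| < #|P j|.

Let proper_of (A B : {group gT}) : A \subset B -> #|A| < #|B| -> A \proper B.
Proof. by move=> AB lt; rewrite properEcard AB. Qed.

(** If P_k were contained in the new group for some k > i, then so would P_{i+1}, which would
    therefore normalise P_0, ..., P_{i+1}, against the choice of i. *)
Lemma new_group_small (k : 'I_n.+1) : normal_index P < k -> #|new_group P| < #|P k|.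
Proof.
move=> ik; have sQ : new_group P \subset P k.
  by apply: new_group_sub_lift; rewrite /= /bump /=; lia.
apply: proper_card; rewrite properE sQ /=; apply/negP => PQ.
have iP : normal_index P < n by apply: leq_trans ik _; rewrite -ltnS.
pose k0 : 'I_n.+1 := inord (normal_index P).+1.
have k0E : k0 = (normal_index P).+1 :> nat by rewrite inordK.
have sk0 : P k0 \subset new_group P.
  by apply: subset_trans PQ; apply: chain_homo; rewrite k0E.
have : normal_upto P k0; last by rewrite -leq_normal_index k0E ltnn.
apply/normal_uptoP => i; rewrite k0E leq_eqVlt => /predU1P[ik0|ii].
  by rewrite (_ : i = k0) ?normG//; apply: val_inj; rewrite /= k0E.
by apply: subset_trans sk0 _; apply/subsetP => g /mem_new_group[_]; apply.
Qed.

Lemma new_group_strict : new_group P != P (normal_index P) ->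
  #|P (normal_index P)| < #|new_group P|.
Proof.
by move=> ne; apply: proper_card; rewrite properEneq sub_new_group andbT eq_sym.
Qed.

Lemma insert_strict : new_group P != P (normal_index P) ->
  injective (fun i => #|insert P i|).
Proof.
move=> /new_group_strict ne i j.
have ne' (k : 'I_n.+1) : #|P k| != #|new_group P|.
  have [ki|ik] := leqP k (normal_index P); last by rewrite gtn_eqF// new_group_small.
  rewrite ltn_eqF//; apply: leq_ltn_trans ne; apply: subset_leq_card; exact: chain_homo.
case: (unliftP (pivot P) i) => [k|] ->; case: (unliftP (pivot P) j) => [l|] ->;
  rewrite ?insert_lift ?insert_pivot //.
- move=> e; congr lift; apply: val_inj => /=; have [/strictP|/strictP|//] := ltngtP k l;
  by rewrite e ltnn.
- by move/eqP; rewrite (negPf (ne' k)).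
- by move/eqP; rewrite eq_sym (negPf (ne' l)).
Qed.

End Strict.

(** The new group normalises everything below it. A larger index for the insertion would make P
    normal up to i + 1 after the new group is deleted. *)
Lemma pivot_normal_index n (P : chain C n) : normal_index (insert P) = pivot P.
Proof.
apply/val_inj/eqP; rewrite eqn_leq andbC leq_normal_index insert_normal_upto /=.
rewrite leqNgt; apply/negP => lt.
pose k0 : 'I_n.+1 := inord (normal_index P).+1.
have ltn1 : (normal_index P).+1 < n.+1.
  by have := ltn_ord (normal_index (insert P)); move: lt; rewrite /= /bump /=; lia.
have k0E : k0 = (normal_index P).+1 :> nat by rewrite inordK.
have lk0 : lift (pivot P) k0 <= normal_index (insert P).
  by move: lt; rewrite /= /bump /= k0E; lia.
have : normal_upto P k0; last by rewrite -leq_normal_index k0E ltnn.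
rewrite leq_normal_index in lk0; move/normal_uptoP: lk0 => h.
apply/normal_uptoP => i ik; have := h (lift (pivot P) i).
by rewrite !insert_lift; apply; rewrite leq_bump2.
Qed.

(** Among isomorphic normal chains a receptive one has the largest normaliser in S: the extension to
    N_S(Q) is injective and, since it carries Q to P, it lands in N_S(P). *)
Lemma receptive_norm_leq n (P Q : chain C n) : receptive_chain P -> chain_rel Q P ->
  Q ord_max \subset chain_norm Q -> #|chain_norm Q| <= #|chain_norm P|.
Proof.
move=> rP QP sQ; have [psi hpsi psiE] := rP Q QP sQ.
have [hm hi hs _] := fhomP (chain_norm_sub Q) (subxx S) hpsi.
rewrite -(card_in_imset hi); apply/subset_leq_card/subsetP => _ /imsetP[u uN ->].
apply/setIP; split; first by apply: (subsetP hs); exact: imset_f.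
apply/bigcapP => i _; rewrite inE -psiE; apply/subsetP => _ /imsetP[_ /imsetP[v vi ->]
  ->].
have vN : v \in chain_norm Q by apply: (subsetP sQ); exact: (subsetP (chain_sub_max Q i)).
rewrite -(morph_conj hm)//; apply: imset_f.
by rewrite -(mem_chain_norm uN i) memJ_conjg.
Qed.

Lemma tight_leq n (P : chain C n) :
  #|new_group P| <= #|P (normal_index P)| -> new_group P = P (normal_index P).
Proof.
by move=> le; apply/group_inj/esym/eqP; rewrite eqEcard sub_new_group.
Qed.

(** R stands for any representative of the class of the insertion, in particular for the chosen
    receptive one. For i < n tightness is inherited along an isomorphism from the insertion. For i =
    n the normaliser of R is contained in that of R with the pivot deleted, whose order is at most
    that of N_S(P) because P is receptive. *)
Lemma insert_tight n (P : chain C n) (R : chain C n.+1) : receptive_chain P ->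
  chain_rel R (insert P) ->
  normal_index R = pivot P /\ new_group R = R (normal_index R).
Proof.
move=> rP RP; have iR : normal_index R = pivot P.
  by rewrite (normal_index_rel RP) pivot_normal_index.
split=> //; apply: tight_leq; rewrite iR (chain_rel_card _ RP) insert_pivot.
have [iP|iP] := ltnP (normal_index P) n.
  have PR : chain_rel (insert P) R by rewrite chain_rel_sym.
  have [phi [_ phiE hm hi]] := chain_relP PR.
  have iI : normal_index (insert P) < n.+1 by rewrite pivot_normal_index.
  rewrite -(new_group_rel iI phiE PR hm hi).
  apply: leq_trans (leq_imset_card _ _) _; apply/subset_leq_card/subsetP => g.
  case/mem_new_group; rewrite /next_group pivot_normal_index ifT// => gU gN.
  apply/mem_new_group; rewrite /next_group iP; split=> [|j ji].
    rewrite -insert_lift (_ : lift _ _ = inord (pivot P).+1)//; apply: val_inj => /=.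
    by rewrite /bump /= !inordK; lia.
  have := gN (lift (pivot P) j); rewrite insert_lift; apply.
  by move: ji; rewrite /= /bump /=; lia.
have {}iP : normal_index P = ord_max.
  by apply/val_inj/eqP; rewrite eqn_leq iP -ltnS ltn_ord.
have iRm : normal_index R = ord_max by rewrite iR /pivot iP; apply: val_inj.
pose R' : chain C n := chain_act (coface (pivot P)) R.
have R'P : chain_rel R' P by rewrite -[P]face_insert; exact: chain_rel_act RP.
have sN : chain_norm R \subset chain_norm R'.
  apply/subsetP => g gN; apply/setIP; split; first exact: (subsetP (chain_norm_sub R)).
  apply/bigcapP => i _; rewrite chain_actE; case/setIP: gN => _ /bigcapP; exact.
rewrite (new_group_max iP) (new_group_max iRm).
apply: leq_trans (subset_leq_card sN) (receptive_norm_leq rP R'P _).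
apply: subset_trans sN; rewrite chain_actE; apply: subset_trans (chain_sub_max R _) _.
by rewrite -(new_group_max iRm) -iRm sub_new_group.
Qed.

(** * Deletion of a group that is its own normaliser step *)

Variable p : nat.
Hypothesis pS : p.-group S.

Lemma proper_norm (A B : {group gT}) : B \subset S -> A \proper B -> A \proper 'N_B(A).
Proof. by move=> BS; apply: nilpotent_proper_norm; exact: pgroup_nil (pgroupS BS pS). Qed.

(** The group V on the left is a p-group containing P_i. If it were larger, the normaliser of P_i in
    V would be larger than P_i too, yet this normaliser is contained in the new group P_i. Hence P_i
    can be recovered from the groups below it and the next group. *)
Lemma tight_norm n (P : chain C n) : new_group P = P (normal_index P) ->
  next_group P :&: \bigcap_(j : 'I_n.+1 | j < normal_index P) 'N(P j) \subset P
    (normal_index P).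
Proof.
move=> tP; pose V := (next_group P :&: \bigcap_(j : 'I_n.+1 | j < normal_index P) 'N(P
  j))%G.
suff: V \subset P (normal_index P) by [].
have sV : P (normal_index P) \subset V.
  rewrite -[in X in X \subset _]tP; apply/subsetP => g /mem_new_group[gU gN].
  by apply/setIP; split=> //; apply/bigcapP => j ji; apply: gN; exact: ltnW.
have VS : V \subset S by apply: subset_trans (next_group_sub P); exact: subsetIl.
apply: contraT => nVP; have : P (normal_index P) \proper V by rewrite properE sV.
move=> /(proper_norm VS)/properP[_ [g /setIP[/setIP[gU /bigcapP gN] gN'] gP]].
case/negP: gP; rewrite -tP; apply/mem_new_group; split=> // j.
rewrite leq_eqVlt => /predU1P[/val_inj -> //|]; exact: gN.
Qed.

(** For i = 0 no normaliser condition remains in [tight_norm], so the next group lies in P_0; by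
    strictness it can only be S. *)
Lemma tight0 n (P : chain C n) : (forall i j : 'I_n.+1, i < j -> #|P i| < #|P j|) ->
  new_group P = P (normal_index P) -> normal_index P = ord0 -> n = 0%N /\ P ord0 = S.
Proof.
move=> strictP tP i0; have := tight_norm tP; rewrite i0 big_pred0 ?setIT//.
rewrite /next_group i0 /=; case: ifP => [n0|/negbT n0] sU.
  have := subset_leq_card sU; rewrite leqNgt strictP// inordK//.
split; first by apply/eqP; rewrite -leqn0 leqNgt.
by apply/group_inj/eqP; rewrite eqEsubset chain_sub sU.
Qed.

Lemma fhom_iso (P Q : {group gT}) phi : P \subset S -> Q \subset S ->
  phi \in fhom F P S -> phi @: P = Q -> Defs.is_iso (fhom F) P Q phi.
Proof.
move=> sP sQ hphi e; have [R [psi [sR ipsi e2]]] := fhom_factor sP (subxx S) hphi.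
have /existsP[psi' iq] := ipsi; have hpsi : psi \in fhom F P R by case/and4P: iq.
have {}e2 : phi = psi by rewrite e2; have [_ ->] := hcomp_incl sP sR hpsi.
rewrite e2 (_ : Q = R)//; apply: val_inj; rewrite /= -e e2.
by have [] := inverse_isosP sP sR iq.
Qed.

(** A tight chain with positive index c is recovered, up to isomorphism, by deleting R_c and
    inserting the new group. The delicate case is that of R_c at the top, where the insertion
    depends on the representative and receptivity of both R and P is used. *)
Lemma tight_insert n (R : chain C n.+1) (P : chain C n) :
  (forall i j : 'I_n.+2, i < j -> #|R i| < #|R j|) ->
  receptive_chain R -> receptive_chain P ->
  new_group R = R (normal_index R) -> normal_index R != ord0 ->
  chain_rel P (chain_act (coface (normal_index R)) R) ->
  new_group P != P (normal_index P) /\ chain_rel R (insert P).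
Proof.
move=> strictR rR rP tR c0; set c := normal_index R; set R' := chain_act _ R => PR'.
have [c' cE] : exists c', c = lift ord0 c'.
  by move: c0; rewrite -/c; case: (unliftP ord0 c) => [c' -> _|->];
    [exists c'|rewrite eqxx].
have cv : c = c'.+1 :> nat by rewrite cE.
have R'E k : R' k = R (lift c k) by rewrite chain_actE mk_dmapE.
have low (k : 'I_n.+1) : k <= c' -> lift c k = k :> nat by move=> kc;
  rewrite /= /bump cv; lia.
have V := tight_norm tR; rewrite -/c in V.
have cR' : c' <= normal_index R'.
  rewrite leq_normal_index; apply/normal_uptoP => i ic; rewrite !R'E.
  have /normal_uptoP h : normal_upto R (lift c c').
    by rewrite -leq_normal_index -/c (low c')// cv.
  by apply: h; rewrite !low.
(* Otherwise R_{c+1} would normalise all groups below R_c, and [tight_norm] would place it inside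
   R_c. *)
have iR' : normal_index R' = c'.
  apply/val_inj/eqP; rewrite eqn_leq cR' andbT leqNgt; apply/negP => lt.
  have cn : c < n.+1 by rewrite cv; exact: leq_trans (ltn_ord (normal_index R')).
  pose k0 : 'I_n.+1 := Ordinal cn.
  have /normal_uptoP h : normal_upto R' k0 by rewrite -leq_normal_index /= cv.
  have k0E : lift c k0 = inord c.+1.
    by apply: val_inj; rewrite /= /bump /= leqnn inordK.
  have /subset_leq_card : R (inord c.+1) \subset R c.
    apply: subset_trans V; rewrite /next_group -/c cn subsetI subxx /=.
    apply/bigcapsP => j jc.
    have jn : j < n.+1 by apply: ltn_trans jc cn.
    have := h (Ordinal jn); rewrite !R'E k0E (_ : lift c (Ordinal jn) = j).
      by apply; rewrite /= ltnW.
    by apply: ord_inj; rewrite low// -ltnS -cv.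
  by rewrite leqNgt strictR// inordK.
have nextE : next_group R' = next_group R.
  rewrite /next_group iR' -/c cv ltnS; case: ifP => // cn.
  rewrite R'E; congr (R _); apply: ord_inj.
  by rewrite [RHS]inordK ?ltnS// /= /bump inordK// cv leqnn.
(* One inclusion is [tight_norm]; the other says that R_c normalises the groups below it. *)
have V' : new_group R' = R c.
  apply/group_inj/eqP; rewrite eqEsubset; apply/andP; split.
    apply: subset_trans V; apply/subsetP => g /mem_new_group[gU gN].
    apply/setIP; split; first by rewrite -nextE.
    apply/bigcapP => j jc; have jn : j < n.+1.
      by move: jc (ltn_ord c'); rewrite cv; lia.
    have := gN (Ordinal jn); rewrite iR' R'E (_ : lift c (Ordinal jn) = j).
      by apply; rewrite -ltnS -cv.
    by apply: ord_inj; rewrite low// -ltnS -cv.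
  rewrite -tR; apply/subsetP => g /mem_new_group[gU gN].
  apply/mem_new_group; split; first by rewrite nextE.
  by move=> j; rewrite iR' R'E => jc; apply: gN; rewrite -/c low// cv; exact: leqW.
have R'P : chain_rel R' P by rewrite chain_rel_sym.
have iP : normal_index P = c' by rewrite -(normal_index_rel R'P).
have pivotE : pivot P = c by rewrite /pivot iP cE.
have ltc : #|P c'| < #|R c|.
  by rewrite -(chain_rel_card _ R'P) R'E strictR// (low c')// cv.
suff RP : chain_rel R (insert P).
  split=> //; apply/negP => /eqP e; move: ltc.
  by rewrite (chain_rel_card c RP) -pivotE insert_pivot e iP ltnn.
(* If R_c is not the top, inserting into R' gives R back, and insertion respects isomorphism. *)
have [lt|ge] := ltnP c' n.
  have <- : insert R' = R; last by apply: insert_rel => //; rewrite iR'.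
  have pR' : pivot R' = c by rewrite /pivot iR' cE.
  apply: chainP => k; case: (unliftP (pivot R') k) => [l|] ->.
    by rewrite insert_lift R'E pR'.
  by rewrite insert_pivot V' pR'.
have c'n : c' = n :> nat by apply/eqP; rewrite eqn_leq ge andbT -ltnS ltn_ord.
have iRm : normal_index R = ord_max by apply: ord_inj; rewrite -/c cv c'n.
have iPm : normal_index P = ord_max by apply: ord_inj; rewrite iP c'n.
have iR'm : normal_index R' = ord_max by apply: ord_inj; rewrite iR' c'n.
have cm : c = ord_max by [].
have NR' : chain_norm R' = R c by rewrite -V' new_group_max.
(* Since P is receptive, some isomorphism from R' to P is defined on all of R_c = N_S(R'). It
   carries R to a chain Y with top I, and deleting I from Y leaves P. *)
have [psi hpsi psiE] : exists2 psi, psi \in fhom F (R c) S & forall i, psi @: R' i = P i.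
  rewrite -NR'; apply: rP => //; rewrite NR' R'E.
  by apply: chain_homo; rewrite cm -ltnS ltn_ord.
have [hm hi hs _] := fhomP (chain_sub R c) (subxx S) hpsi.
pose I := Group (imset_group_set (subxx (R c)) hm).
have IS : I \subset S by [].
have /existsP[psi' ipsi] : Defs.is_iso (fhom F) (R c) I psi.
  exact: fhom_iso (chain_sub R c) IS hpsi _.
rewrite cm in ipsi; have [Y [YI YE]] := transport_chain IS ipsi.
have YP k : Y (lift c k) = P k.
  by apply: group_inj; rewrite /= -YE -psiE R'E.
have RY : chain_rel R Y.
  apply/existsP; exists psi; rewrite YI; apply/andP; split; first by apply/existsP;
    exists psi'.
  by apply/forallP => i; rewrite YE.
have YR : chain_rel Y R by rewrite chain_rel_sym.
have IT : I \subset new_group P.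
  apply/subsetP => u uI; apply/mem_new_group; rewrite /next_group iPm ltnn.
  split=> [|k _]; first exact: (subsetP IS).
  rewrite -YP; move: uI => /imsetP[t tc ->]; rewrite inE -YE.
  apply/subsetP => _ /imsetP[_ /imsetP[s si ->] ->].
  have sc : s \in R c by rewrite cm; apply: subsetP s si; exact: chain_sub_max.
  rewrite -(morph_conj hm)//; apply: imset_f; rewrite memJ_norm//.
  have tc' : t \in new_group R by rewrite tR.
  case/mem_new_group: tc' => _; apply; by rewrite iRm -ltnS ltn_ord.
(* If I were smaller than N_S(P), its normaliser there would be larger than I and would normalise Y.
   But N_S(Y) has order at most that of N_S(R), which is the order of I, because R is receptive. *)
have IE : I = new_group P.
  apply/group_inj/eqP; rewrite eqEsubset IT /=; apply: contraT => nIT.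
  have : I \proper new_group P by rewrite properE IT.
  move=> /(proper_norm (new_group_sub P))/proper_card; rewrite ltnNge => /negP[].
  have Yc k : k = c \/ exists l, k = lift c l.
    by case: (unliftP c k) => [l|] ->; [right; exists l|left].
  have -> : #|I| = #|chain_norm R|.
    by rewrite -(new_group_max iRm) tR /= card_in_imset.
  apply: leq_trans (receptive_norm_leq rR YR _); last first.
    rewrite YI; apply/subsetP => u uI; apply/setIP; split; first exact: (subsetP IS).
    apply/bigcapP => k _; case: (Yc k) => [->|[l ->]]; rewrite ?YP.
      by rewrite cm YI (subsetP (normG I)).
    by have /mem_new_group[_] := subsetP IT u uI; apply; rewrite iPm -ltnS ltn_ord.
  apply/subset_leq_card/subsetP => u /setIP[/mem_new_group[uU uN] uI].
  apply/setIP; split; first by move: uU; rewrite /next_group iPm ltnn.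
  apply/bigcapP => k _; case: (Yc k) => [->|[l ->]]; rewrite ?YP.
    by rewrite cm YI.
  by apply: uN; rewrite iPm -ltnS ltn_ord.
have <- : Y = insert P; last by [].
apply: chainP => k; case: (unliftP (pivot P) k) => [l|] ->.
  by rewrite insert_lift pivotE YP.
by rewrite insert_pivot pivotE cm YI IE.
Qed.

End Classes.

From mathcomp Require Import all_classical reals topology normedtype.
Import numFieldNormedType.Exports.

(** * The simplex category and geometric realizations *)

Section SimplexCategory.
Local Open Scope nat_scope.

Lemma dmap_inj_lt m n (f : dmap m n) (i j : 'I_m.+1) :
  injective f -> i < j -> f i < f j.
Proof.
move=> fi ij; rewrite ltn_neqAle dfun_homo ?(ltnW ij)// andbT.
by apply: contraTneq ij => /val_inj/fi ->; rewrite ltnn.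
Qed.

Lemma dmap_inj_leq m n (f : dmap m n) : injective f -> m <= n.
Proof. by move=> /leq_card; rewrite !card_ord. Qed.

Lemma dmap_inj_id n (f : dmap n n) : injective f -> f = did n.
Proof.
move=> fi; apply: dmapP => i; rewrite mk_dmapE.
have [g fg gf] := injF_bij fi.
have [k] := ubnP (i : nat); elim: k i => // k IH i /ltnSE ik.
have [lt_gi|lt_ig|/val_inj eq_gi] := ltngtP (g i) i.
- by move: (IH (g i) (leq_trans lt_gi ik)); rewrite gf => e; rewrite -e ltnn in lt_gi.
- have := dmap_inj_lt fi lt_ig; rewrite gf => lt_fi.
  by move/fi: (IH (f i) (leq_trans lt_fi ik)).
- by rewrite -[in LHS]eq_gi gf.
Qed.

Lemma dmap_avoid m n (f : dmap m n.+1) (j : 'I_n.+2) :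
  (forall i, f i != j) -> exists u : dmap m n, f = dcomp (coface j) u.
Proof.
move=> fj; have u i : {k | f i = lift j k}.
  by case: (unliftP j (f i)) (fj i) => [k -> _|->]; [exists k|rewrite eqxx].
have uh (a b : 'I_m.+1) : a <= b -> sval (u a) <= sval (u b).
  move=> ab; rewrite -(leq_bump2 j).
  by have := dfun_homo f ab; case: (u a) (u b) => [x /= ->] [y /= ->].
exists (mk_dmap uh); apply: dmapP => i.
by rewrite !mk_dmapE; exact: svalP (u i).
Qed.

Lemma dmap_inj_coface n (f : dmap n n.+1) : injective f -> exists j, f = coface j.
Proof.
move=> fi; have [j fj] : exists j, forall i, f i != j.
  apply: contrapT => /forallNP h.
  have : #|'I_n.+2| <= #|codom f|.
    apply/subset_leq_card/fintype.subsetP => j _; apply: contraT => jf.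
    by case: (h j) => i; apply: contraNneq jf => <-; exact: codom_f.
  by rewrite card_codom// !card_ord ltnn.
have [u e] := dmap_avoid fj; exists j.
have ui : injective u.
  by move=> a b ab; apply: fi; rewrite e !mk_dmapE ab.
by rewrite e (dmap_inj_id ui); apply: dmapP => i; rewrite !mk_dmapE.
Qed.

(** Any choice of preimages is monotone, because g is strictly increasing and f is monotone. *)
Lemma dmap_section l m n (f : dmap m n) (g : dmap l n) : injective g ->
  (forall k, exists i, f i = g k) -> exists s : dmap l m, dcomp f s = g.
Proof.
move=> gi fg; have {fg} [s sP] := choice fg.
have sh (a b : 'I_l.+1) : a <= b -> s a <= s b.
  rewrite leq_eqVlt => /predU1P[/val_inj -> //|ab].
  have := dmap_inj_lt gi ab; rewrite -!sP; apply: contraTT.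
  by rewrite -leqNgt -ltnNge => /ltnW/dfun_homo.
by exists (mk_dmap sh); apply: dmapP => i; rewrite !mk_dmapE.
Qed.

Lemma coface_inj n (j : 'I_n.+2) : injective (coface j).
Proof. by move=> a b; rewrite !mk_dmapE => /lift_inj. Qed.

(** For j distinct from i, the monotone retraction onto the face opposite j that sends j to its
    neighbour on the side of i. Being an endomap, it presents that face as a simplex of unchanged
    dimension. *)
Definition squash_fun n (i j k : 'I_n.+1) : 'I_n.+1 :=
  if k == j then inord (if j < i then j.+1 else j.-1) else k.

Lemma squash_lt n (i j : 'I_n.+1) : (if j < i then j.+1 else j.-1) < n.+1.
Proof. by case: ifP => ij; have := ltn_ord i; have := ltn_ord j; lia. Qed.

Lemma squash_homo n (i j a b : 'I_n.+1) :
  a <= b -> squash_fun i j a <= squash_fun i j b.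
Proof.
have H := squash_lt i j.
rewrite /squash_fun -!(inj_eq val_inj) /=.
by case: eqP; case: eqP; rewrite ?inordK//; case: ifP; lia.
Qed.

Definition squash n (i j : 'I_n.+1) : dmap n n := mk_dmap (@squash_homo n i j).

Lemma squashE n (i j k : 'I_n.+1) : k != j -> squash i j k = k.
Proof. by rewrite mk_dmapE /squash_fun => /negPf ->. Qed.

Lemma squash_val n (i j : 'I_n.+1) : (squash i j j : nat) = if j < i then j.+1 else j.-1.
Proof. by rewrite mk_dmapE /squash_fun eqxx inordK// squash_lt. Qed.

Lemma squash_avoid n (i j k : 'I_n.+1) : j != i -> squash i j k != j.
Proof.
move=> ji; have [->|kj] := eqVneq k j; last by rewrite squashE.
by rewrite -(inj_eq val_inj) /= squash_val; move: ji; rewrite -(inj_eq val_inj) /=;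
  case: ifP; lia.
Qed.

Lemma squash_comp m n (i j : 'I_n.+1) (f : dmap m n) :
  (forall k, f k != j) -> dcomp (squash i j) f = f.
Proof. by move=> fj; apply: dmapP => k; rewrite mk_dmapE squashE. Qed.

(** As [squash] moves towards [i], it cannot exchange two neighbours, so in a
    suitable order the two squashes avoid both vertices. *)
Lemma squash2 n (i j k : 'I_n.+1) : j != i -> k != i ->
  exists f : dmap n n, [/\ forall l, f l != j, forall l, f l != k &
    forall l, l != j -> l != k -> f l = l].
Proof.
move=> ji ki; have [<-|jk] := eqVneq j k.
  by exists (squash i j); split=> l; [exact: squash_avoid|exact: squash_avoid|]; move=>
    lj _; exact: squashE.
wlog h : j k ji ki jk / squash i k k != j => [IH|].
  have [e|] := eqVneq (squash i k k) j; last exact: IH.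
  have h : squash i j j != k.
    move: e jk ji ki => /(congr1 val); rewrite -!(inj_eq val_inj) /= !squash_val.
    by case: ifP; case: ifP; lia.
  have [|f [f1 f2 f3]] := IH k j ki ji _ h; first by rewrite eq_sym.
  by exists f; split=> // l lj lk; exact: f3.
exists (dcomp (squash i k) (squash i j)); split=> l; rewrite mk_dmapE.
- have [->//|e] := eqVneq (squash i j l) k.
  by rewrite squashE// squash_avoid.
- exact: squash_avoid.
- by move=> lj lk; rewrite (squashE i lj) squashE.
Qed.

End SimplexCategory.

(** * Gluing of continuous maps and products with quotient maps *)

Section Topology.
Local Open Scope classical_set_scope.

(** The pasting lemma, for joining the phases of a homotopy on one cell. *)
Lemma continuous_closed_cover (T Z : topologicalType) (I : finType)
    (K : I -> set T) (g : I -> T -> Z) (f : T -> Z) :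
  (forall i, closed (K i)) -> (forall i, continuous (g i)) ->
  (forall i x, K i x -> f x = g i x) -> (forall x, exists i, K i x) ->
  continuous f.
Proof.
move=> cK cg fg cov; apply/continuous_closedP => A cA.
rewrite (_ : f @^-1` A = \bigcup_(i in [set: I]) (K i `&` g i @^-1` A)).
  apply: closed_bigcup => [|i _]; first exact: finite_finset.
  apply: closedI => //.
  by move/continuous_closedP: (cg i); exact.
apply/seteqP; split=> x /=; last by move=> [i _ [Ki]] /=; rewrite -(fg i).
by move=> Afx; have [i Ki] := cov x; exists i => //; split=> //=; rewrite -(fg i).
Qed.

(** Whitehead's lemma on products of a quotient map with a locally compact space,
    by the tube lemma. *)
Lemma quotient_continuous_prod (K P Z : topologicalType) (Q : quotType P)
    (f : K * quotient_topology Q -> Z) :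
  (forall (y : K) (B : set K), nbhs y B ->
    exists V, [/\ nbhs y V, compact V & V `<=` B]) ->
  continuous (fun z : K * P => f (z.1, (\pi_(quotient_topology Q) z.2)%qT)) ->
  continuous f.
Proof.
move=> lcK /continuousP cf; apply/continuousP => A /cf oW.
rewrite openE => -[y q] /= Ayq; have [p qE] : exists p,
  q = (\pi_(quotient_topology Q) p)%qT.
  by exists (generic_quotient.repr q); rewrite reprK.
have [[B D] /= [nB nD] BD] : nbhs (y, p) (fun z : K * P => A (f (z.1,
  (\pi_(quotient_topology Q) z.2)%qT))).
  by apply: open_nbhs_nbhs; split=> //=; rewrite -qE.
have [V [nV cV VB]] := lcK _ _ nB.
(* The points over which the whole compact set V is mapped into A; compactness of V makes W open. *)
pose W := [set q' | V `<=` [set y' | A (f (y', q'))]].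
have oW' : open W.
  rewrite /open /= /quotient_open openE => p' Wp'.
  rewrite /interior; apply: ((compact_near_coveringP V).1 cV) => y' Vy'.
  have : nbhs (y', p') (fun z : K * P => A (f (z.1, (\pi_(quotient_topology Q) z.2)%qT))).
    by apply: open_nbhs_nbhs; split=> //=; exact: Wp'.
  by [].
have Wq : W q.
  by move=> y' Vy'; rewrite qE; apply: (BD (y', p)); split;
    [exact: VB|exact: nbhs_singleton].
exists (V, W); first by split=> //=; exact: open_nbhs_nbhs.
by case=> y' q' [/= Vy' Wq']; exact: Wq'.
Qed.

Lemma continuous_curry2 (T U V W : topologicalType) (h : U -> V -> W)
    (f : T -> U) (g : T -> V) :
  continuous (fun z : U * V => h z.1 z.2) -> continuous f -> continuous g ->
  continuous (fun x => h (f x) (g x)).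
Proof.
move=> ch cf cg x; apply: continuous2_cvg; [exact: (ch (f x, g x))|exact: cf|exact: cg].
Qed.

Lemma subtype_row_continuous (R : realType) (T : topologicalType) n
    (A : set 'rV[R]_n) (f : T -> A) :
  (forall i, continuous (fun x => set_val (f x) ord0 i)) -> continuous f.
Proof.
move=> cf x U [_ [[B oB <-] Bfx] BU].
move: oB; rewrite openE => /(_ _ Bfx) [P nP PB].
have : \forall y \near x, forall i, P ord0 i (set_val (f y) ord0 i).
  apply: filter_forall => i; apply: cf; exact: nP.
by apply: filterS => y yP; apply: BU => /=; apply: PB => i j; rewrite ord1; exact: yP.
Qed.

End Topology.

(** * Barycentric coordinates and homotopies on a realization *)

Section Realization.
Local Open Scope classical_set_scope.
Local Open Scope ring_scope.
Variables (R : realType) (X : sset).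

Definition bary n (p : std_simplex R n) (i : 'I_n.+1) : R := set_val p ord0 i.

Lemma bary_ge0 n (p : std_simplex R n) i : 0 <= bary p i.
Proof. by have [p0 p1] := set_valP p; first [exact: p0|exact: p1]. Qed.

Lemma bary_sum n (p : std_simplex R n) : \sum_i bary p i = 1.
Proof. by have [p0 p1] := set_valP p; first [exact: p0|exact: p1]. Qed.

Lemma baryP n (p q : std_simplex R n) : bary p =1 bary q -> p = q.
Proof. by move=> pq; apply: val_inj; apply/rowP => i; exact: pq. Qed.

Lemma bary_push m n (f : dmap m n) (p : std_simplex R m) j :
  bary (push f p) j = \sum_(i | f i == j) bary p i.
Proof. by rewrite /bary /push /= mxE. Qed.

Lemma push_comp l m n (g : dmap m n) (f : dmap l m) (p : std_simplex R l) :
  push (dcomp g f) p = push g (push f p).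
Proof.
apply: baryP => j; rewrite !bary_push.
rewrite (partition_big f (fun i => g i == j)) /= => [|i]; last by rewrite mk_dmapE.
apply: eq_bigr => k /eqP gk; rewrite bary_push; apply: eq_bigl => i.
by rewrite ?mk_dmapE; have [->|_] := eqVneq (f i) k; rewrite ?gk ?eqxx ?andbF.
Qed.

(** Applied to [squash], this fixes the points of the face onto which it retracts. *)
Lemma push_support n (f : dmap n n) (p : std_simplex R n) :
  (forall i, bary p i != 0 -> f i = i) -> push f p = p.
Proof.
move=> fp; apply: baryP => j; rewrite bary_push.
have [pj|pj] := eqVneq (bary p j) 0.
  rewrite pj big1// => i /eqP fi; apply/eqP; apply: contraT => pi.
  by move: (pi); rewrite -[i in bary p i](fp i pi) fi pj eqxx.
rewrite (bigD1 j)/= ?fp// big1 ?addr0// => i /andP[/eqP fi ij].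
by apply/eqP; apply: contraNT ij => pi; rewrite -fi fp.
Qed.

Lemma bary_continuous n i : continuous (fun p : std_simplex R n => bary p i).
Proof.
move=> p; apply: (@continuous_comp _ _ _ (set_val : std_simplex R n ->
  'rV[R]_n.+1) (fun M : 'rV[R]_n.+1 => M ord0 i)).
  exact: initial_continuous.
exact: coord_continuous.
Qed.

Lemma continuous_sum (T : topologicalType) (I : Type) (r : seq I) (P : pred I) (g : I ->
  T -> R) :
  (forall i, continuous (g i)) -> continuous (fun x => \sum_(i <- r | P i) g i x).
Proof.
move=> cg x; elim: r => [|i r IH].
  by under [X in continuous_at _ X]eq_fun do rewrite big_nil; exact: cst_continuous.
under [X in continuous_at _ X]eq_fun do rewrite big_cons.
case: (P i) => //; apply: continuousD => //; exact: cg.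
Qed.

Lemma push_continuous m n (f : dmap m n) : continuous (push f : std_simplex R m -> _).
Proof.
apply: subtype_row_continuous => j; rewrite /= -/(bary _ _).
under [X in continuous X]eq_fun do rewrite -/(bary _ _) bary_push.
by apply: continuous_sum => i; exact: bary_continuous.
Qed.

Definition rpoint n (x : X n) (p : std_simplex R n) : realization R X :=
  (\pi_(realization R X) (ppoint x p))%qT.

Lemma rpoint_act m n (f : dmap m n) (x : X n) p :
  rpoint (sact f x) p = rpoint x (push f p).
Proof. by apply/eqmodP/asboolP; apply: rst_step; constructor. Qed.

Lemma rpoint_continuous n (x : X n) : continuous (rpoint x).
Proof.
move=> p; apply: (@continuous_comp _ _ _ (ppoint x)).
  exact: (@existT_continuous _ (fun y : simplex X => std_simplex R (tag y) :
    topologicalType)).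
exact: (@pi_continuous _ (realization R X)).
Qed.

Lemma realizationP (z : realization R X) : exists n (x : X n) p, z = rpoint x p.
Proof.
rewrite -[z]reprK; case: (generic_quotient.repr z) => -[n x] p.
by exists n, x, p.
Qed.

(** Compatibility with [sact] is compatibility with the gluing relation. Continuity descends to the
    quotient because closed intervals supply small compact neighbourhoods on the time line. *)
Lemma realization_homotopy (Z : topologicalType) (h : forall n, X n -> R ->
  std_simplex R n -> Z) :
  (forall n (x : X n), continuous (fun z : R * std_simplex R n => h n x z.1 z.2)) ->
  (forall m n (f : dmap m n) (x : X n) s p, h m (sact f x) s p = h n x s (push f p)) ->
  exists2 H : R * realization R X -> Z, continuous H &
    forall n (x : X n) s p, H (s, rpoint x p) = h n x s p.
Proof.
move=> ch hE.
pose h' (s : R) (a : presentation R X) := h _ (tagged (tag a)) s (tagged a).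
have h'E s a b : glue_rel a b -> h' s a = h' s b.
  move=> /asboolP; elim=> {a b} //.
  - by move=> a b [m n f x p]; exact: hE.
  - by move=> a b c _ -> _ ->.
pose H (z : R * realization R X) := h' z.1 (generic_quotient.repr z.2).
have HE s a : H (s, (\pi_(realization R X) a)%qT) = h' s a.
  by apply: h'E; have /eqmodP := reprK (\pi_(realization R X) a)%qT.
exists H; last by move=> n x s p; rewrite HE.
apply: quotient_continuous_prod.
  move=> y B /nbhs_ballP[e /= e0 eB].
  exists [set` `[y - e / 2, y + e / 2]]; split; last 2 first.
  - exact: segment_compact.
  - move=> z; rewrite /= in_itv/= => /andP[z1 z2]; apply: eB.
    by rewrite /ball /= ltr_norml; apply/andP; split; lra.
  - apply/nbhs_ballP; exists (e / 2) => /=; first by rewrite divr_gt0.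
    move=> z; rewrite /ball /= ltr_norml in_itv/= => /andP[z1 z2].
    by apply/andP; split; lra.
move=> [s [[n x] p]] U /=; rewrite HE /h' /= => nU.
have [[B D] /= [nB nD] BD] := ch n x (s, p) U nU.
pose T_ (y : simplex X) : topologicalType := std_simplex R (tag y).
exists (B, existT T_ (Tagged (spx X) x) @` D).
  by split=> //=; exact: (@existT_nbhs _ T_).
case=> s' a' /= [Bs' [p' Dp' <-]]; rewrite HE; exact: (BD (s', p')).
Qed.

End Realization.

(** * Sliding a simplex off one of its faces *)

Section Slide.
Local Open Scope classical_set_scope.
Local Open Scope ring_scope.
Variables (R : realType) (N : nat) (i0 : 'I_N.+1).
Implicit Type p : std_simplex R N.

(** Keeps a slide stationary before time 0 and after time 1, so that time can be any real number. *)
Definition clamp (s : R) : R := Num.min 1 (Num.max 0 s).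

Lemma clamp_itv s : 0 <= clamp s <= 1.
Proof. by rewrite /clamp le_min ler01 le_max lexx/= ge_min lexx. Qed.

Lemma clamp0 s : s <= 0 -> clamp s = 0.
Proof. by move=> s0; rewrite /clamp (max_idPl s0) (min_idPr ler01). Qed.

Lemma clamp1 s : 1 <= s -> clamp s = 1.
Proof. by move=> s1; rewrite /clamp (max_idPr (le_trans ler01 s1)) (min_idPl s1). Qed.

Lemma clamp_continuous : continuous clamp.
Proof.
move=> s; apply: continuous_min; first exact: cst_continuous.
apply: continuous_max; first exact: cst_continuous.
exact: cvg_id.
Qed.

(** The initial value 1 of the minimum is harmless, since barycentric coordinates are at most 1. *)
Definition min_off p : R := \big[Num.min/1]_(i | i != i0) bary p i.

Lemma min_off_continuous : continuous min_off.
Proof.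
rewrite /min_off => p; elim: (index_enum _) => [|i r IH].
  under [X in continuous_at _ X]eq_fun do rewrite big_nil; exact: cst_continuous.
under [X in continuous_at _ X]eq_fun do rewrite big_cons.
case: (i != i0) => //; apply: continuous_min => //; exact: bary_continuous.
Qed.

Lemma min_off_ge0 p : 0 <= min_off p.
Proof. by apply/bigmin_geP; split=> // i _; exact: bary_ge0. Qed.

Lemma min_off_le p i : i != i0 -> min_off p <= bary p i.
Proof. by move=> ii; exact: bigmin_le_cond. Qed.

Lemma bary_le1 p i : bary p i <= 1.
Proof. by rewrite -(bary_sum p) (bigD1 i)//= lerDl sumr_ge0// => j _;
  exact: bary_ge0. Qed.

Lemma min_off_attained p j : j != i0 -> exists2 i, i != i0 & bary p i = min_off p.
Proof.
move=> ji; rewrite /min_off.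
by have [|i ii ->] := @eq_bigmin _ R _ 1 j (fun i => i != i0) (bary p) ji; [move=> i _;
  exact: bary_le1|exists i].
Qed.

(** Each of the N coordinates off [i0] loses the same amount and [i0] gains all of it, so the sum
    stays 1. Coordinates stay nonnegative because the loss is at most their minimum. *)
Definition slide_row (s : R) p : 'rV[R]_N.+1 :=
  \row_i (if i == i0 then bary p i0 + N%:R * (clamp s * min_off p)
          else bary p i - clamp s * min_off p).

Lemma slide_subproof s p : slide_row s p \in std_simplex R N.
Proof.
have /andP[c0 c1] := clamp_itv s; have m0 := min_off_ge0 p.
apply/mem_set; split=> [i|].
  rewrite mxE; case: eqP => [_|/eqP ii]; first by rewrite addr_ge0 ?bary_ge0// mulr_ge0//
    mulr_ge0.
  have := min_off_le p ii; nra.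
rewrite -(bary_sum p) (bigD1 i0)//= mxE eqxx [RHS](bigD1 i0)//= -addrA; congr +%R.
under eq_bigr => i ii do rewrite mxE (negPf ii).
rewrite sumrB sumr_const cardC1 card_ord -mulr_natl/=; lra.
Qed.

(** Moves [p] towards the vertex [i0], parallel to the line joining it to the
    barycentre of the opposite face, until at time 1 it reaches another face. *)
Definition slide s p : std_simplex R N := exist (fun v =>
  v \in std_simplex R N) _ (slide_subproof s p).

Lemma bary_slide s p i : bary (slide s p) i =
  if i == i0 then bary p i0 + N%:R * (clamp s * min_off p)
  else bary p i - clamp s * min_off p.
Proof. by rewrite /bary /slide /= mxE. Qed.

Lemma slide0 s p : s <= 0 -> slide s p = p.
Proof.
move=> s0; apply: baryP => i; rewrite bary_slide clamp0// !mul0r mulr0 addr0 subr0.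
by case: eqP => [->|].
Qed.

(** The faces opposite vertices other than [i0] do not move, so a slide is compatible with a
    homotopy already given there. *)
Lemma slide_face s p i : i != i0 -> bary p i = 0 -> slide s p = p.
Proof.
move=> ii pi0; have m0 : min_off p = 0.
  by apply: le_anti; rewrite min_off_ge0 -{1}pi0 min_off_le.
apply: baryP => j; rewrite bary_slide m0 !mulr0 addr0 subr0.
by case: eqP => [->|].
Qed.

Lemma slide1 p j : j != i0 -> exists2 i, i != i0 & bary (slide 1 p) i = 0.
Proof.
move=> ji; have [i ii e] := min_off_attained p ji.
by exists i => //; rewrite bary_slide (negPf ii) clamp1// mul1r e subrr.
Qed.

Lemma slide_continuous : continuous (fun z : R * std_simplex R N => slide z.1 z.2).
Proof.
have cm : continuous (fun z : R * std_simplex R N => clamp z.1 * min_off z.2).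
  move=> z; apply: cvgM.
    apply: (@continuous_comp _ _ _ fst clamp); [exact: cvg_fst|exact: clamp_continuous].
  apply: (@continuous_comp _ _ _ snd min_off); [exact: cvg_snd|exact: min_off_continuous].
have cb i : continuous (fun z : R * std_simplex R N => bary z.2 i).
  move=> z; apply: (@continuous_comp _ _ _ snd (fun p => bary p i));
    [exact: cvg_snd|exact: bary_continuous].
apply: subtype_row_continuous => i.
under [X in continuous X]eq_fun do rewrite -/(bary _ _) bary_slide.
case: eqP => _ z; last by apply: cvgB; [exact: cb|exact: cm].
apply: cvgD; first exact: cb.
by apply: cvgM; [exact: cvg_cst|exact: cm].
Qed.

End Slide.

(** * Collapsing along a matching *)

Section Ranked.
Local Open Scope nat_scope.
Variables (X : sset) (rk : forall n, X n -> 'I_n.+1 -> nat).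
Arguments rk {n}.
Hypothesis rk_act : forall m n (f : dmap m n) (x : X n) i,
  rk (sact f x) i = rk x (f i).
Hypothesis rk_lt : forall n (x : X n), Defs.nondegenerate x ->
  forall i j : 'I_n.+1, i < j -> rk x i < rk x j.

Lemma rk_inj n (x : X n) : Defs.nondegenerate x -> injective (rk x).
Proof.
move=> nx i j e; have [ij|ji|/val_inj//] := ltngtP i j.
  by have := rk_lt nx ij; rewrite e ltnn.
by have := rk_lt nx ji; rewrite e ltnn.
Qed.

(** The degeneracy at j gives the vertices j and j + 1 the same label. *)
Lemma rk_nondegenerate n (x : X n) : injective (rk x) -> Defs.nondegenerate x.
Proof.
case: n x => // n x xi j y e.
have : (inord j : 'I_n.+2) = inord j.+1.
  apply: xi; rewrite e /degen !rk_act; congr rk; apply: val_inj => /=.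
  have jn := ltn_ord j.
  rewrite !mk_dmapE /= !inordK ?ltnS//; last exact: ltnW.
  by rewrite /unbump ltnn ltnSn subn0 subn1.
have jn := ltn_ord j; move=> /(congr1 val)/eqP /=.
by rewrite !inordK ?ltnS// ?ltn_eqF// ltnW.
Qed.

Lemma act_nondegenerate m n (f : dmap m n) (x : X n) :
  Defs.nondegenerate x -> injective f -> Defs.nondegenerate (sact f x).
Proof.
move=> nx fi; apply: rk_nondegenerate => i j.
by rewrite !rk_act => /(rk_inj nx)/fi.
Qed.

Lemma nondegenerate_inj m n (f : dmap m n) (x : X n) :
  Defs.nondegenerate (sact f x) -> injective f.
Proof. by move=> nx i j e; apply: (rk_inj nx); rewrite !rk_act e. Qed.

(** * Matchings along which a weight decreases *)

Section Matching.
Variable M : morse_data X.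
Local Notation red := (redundant_cells M).
Local Open Scope classical_set_scope.
Hypothesis matchM :
  [/\ [/\ critical_cells M `|` red `|` collapsible_cells M = @cells X,
          critical_cells M `&` red = set0,
          critical_cells M `&` collapsible_cells M = set0 &
          red `&` collapsible_cells M = set0],
      set_bij red (collapsible_cells M) (mate_simplex M) &
      forall n (t : X n), red (Tagged (spx X) t) ->
        t = face (idx M t) (mate M t)].
Variable w : simplex X -> nat.
Hypothesis w_dim : forall t t', red t -> red t' -> tag t < tag t' -> w t < w t'.
Hypothesis w_face : forall n (t : X n) j, red (Tagged (spx X) t) ->
  j <> idx M t -> red (Tagged (spx X) (face j (mate M t))) ->
  w (Tagged (spx X) (face j (mate M t))) < w (Tagged (spx X) t).

Lemma red_nondegenerate t : red t -> Defs.nondegenerate (tagged t).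
Proof.
move: matchM => [[/seteqP[h _] _ _ _] _ _] rt.
by apply: (h t); left; right.
Qed.

Lemma coll_nondegenerate t : collapsible_cells M t -> Defs.nondegenerate (tagged t).
Proof.
move: matchM => [[/seteqP[h _] _ _ _] _ _] rt.
by apply: (h t); right.
Qed.

Lemma mate_coll t : red t -> collapsible_cells M (mate_simplex M t).
Proof. by move: matchM => [_ [h _ _] _]; exact: h. Qed.

Lemma coll_mate z : collapsible_cells M z -> exists2 t, red t & mate_simplex M t = z.
Proof. by move: matchM => [_ [_ _ h] _]; exact: h. Qed.

Lemma mate_nondegenerate t : red t -> Defs.nondegenerate (mate M (tagged t)).
Proof. by move/mate_coll/coll_nondegenerate. Qed.

Lemma red_coll t : red t -> collapsible_cells M t -> False.
Proof. by move: matchM => [[_ _ _ /seteqP[h _]] _ _] rt ct; exact: (h t). Qed.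

Lemma red_face n (t : X n) : red (Tagged (spx X) t) -> t = face (idx M t) (mate M t).
Proof. by move: matchM => [_ _ h]; exact: h. Qed.

(** A redundant cell can only step to its mate. From the mate of t a path steps either to a
    redundant face, of smaller weight by [w_face], or to a collapsible face, which is the mate of a
    cell of smaller dimension and so of smaller weight by [w_dim]. Infinite paths are excluded by
    induction on a bound for the weight. *)
Lemma no_infinite_path :
  ~ exists path : nat -> simplex X, forall k, morse_edge M (path k) (path k.+1).
Proof.
have edge_red t z : red t -> morse_edge M t z -> z = mate_simplex M t.
  move=> + e; case: e => // n u j ru _ _ rm.
  by case: (red_coll rm (mate_coll ru)).
have edge_mate t z : red t -> morse_edge M (mate_simplex M t) z ->
    exists t', [/\ red t', w t' < w t & z = t' \/ z = mate_simplex M t'].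
  move=> rt; move e: (mate_simplex M t) => y yz.
  case: yz e => [n u ru|n u j ru ju fz] e.
    by case: (red_coll ru); rewrite -e; exact: mate_coll.
  have {e} e : t = Tagged (spx X) u.
    move: matchM => [_ [_ hi _] _]; apply: hi; rewrite ?inE//.
  rewrite e in rt *; case: fz => [fr|/coll_mate[t' rt' et']].
    by exists (Tagged (spx X) (face j (mate M u))); split=> //; [exact: w_face|left].
  exists t'; split=> //; last by right.
  by apply: w_dim => //; have := congr1 tag et' => /= <-.
suff H k t : red t -> w t < k -> forall path : nat -> simplex X,
    (path 0 = t \/ path 0 = mate_simplex M t) ->
    ~ forall i, morse_edge M (path i) (path i.+1).
  move=> [path pP].
  have [t [rt h]] : exists t, red t /\ (path 0 = t \/ path 0 = mate_simplex M t).
    by case: (pP 0) => n t => [rt|j rt _ _];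
      exists (Tagged (spx X) t); split=> //; [left|right].
  exact: (H _ _ rt (leqnn _) path h pP).
elim: k t => // k IH t rt /ltnSE wt path.
have main q : q 0 = mate_simplex M t -> ~ forall i, morse_edge M (q i) (q i.+1).
  move=> q0 qP; have := qP 0; rewrite q0 => /(edge_mate _ _ rt)[t' [rt' wt' h]].
  exact: (IH t' rt' (leq_trans wt' wt) (fun i => q i.+1) h (fun i => qP i.+1)).
case=> [p0 pP|p0]; last exact: main.
apply: (main (fun i => path i.+1)) => //.
by apply: edge_red rt _; rewrite -p0; exact: pP.
Qed.

(** * Filtration by weight *)

Variable v : X 0.
Hypothesis critE : critical_cells M = [set Tagged (spx X) v].

(** Membership of [x] in the simplicial subset generated by [y]. *)
Definition acts_from (y x : simplex X) :=
  exists f : dmap (tag x) (tag y), tagged x = sact f (tagged y).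

(** A filtration by simplicial subsets: passing from k to k + 1 attaches the matched pairs of weight
    k, a redundant cell being a face of its mate. *)
Definition stage (k : nat) (x : simplex X) :=
  acts_from (Tagged (spx X) v) x \/
  exists t, [/\ red t, w t < k & acts_from (mate_simplex M t) x].

Lemma stage_act k m n (f : dmap m n) (x : X n) :
  stage k (Tagged (spx X) x) -> stage k (Tagged (spx X) (sact f x)).
Proof.
case=> [[g /= e]|[t [rt wt [g /= e]]]]; [left|right].
  by exists (dcomp g f); rewrite /= e sact_comp.
by exists t; split=> //; exists (dcomp g f); rewrite /= e sact_comp.
Qed.

Lemma stage_cell k z : Defs.nondegenerate (tagged z) ->
  (forall t, red t -> z = t \/ z = mate_simplex M t -> w t < k) -> stage k z.
Proof.
move=> nz h; have : @cells X z by [].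
move: matchM => [[<- _ _ _] _ _]; case=> [[|rz]|].
- rewrite critE => ->; left; exists (did 0); by rewrite sact_id.
- right; exists z; split=> //; first by apply: h => //; left.
  case: z rz {nz h} => n t rt; exists (coface (idx M t)) => /=; exact: red_face.
- move=> /coll_mate[t rt e]; right; exists t; split=> //; first by apply: h => //; right.
  rewrite e; exists (did _); by rewrite sact_id.
Qed.

(** A redundant face has smaller weight by [w_face]; a collapsible one is the mate of a cell of
    smaller dimension; a critical one is v. So a new mate is attached along all its faces but the
    matched one. *)
Lemma stage_face n (t : X n) j : red (Tagged (spx X) t) -> j != idx M t ->
  stage (w (Tagged (spx X) t)) (Tagged (spx X) (face j (mate M t))).
Proof.
move=> rt /eqP jt; apply: stage_cell => /=.
  exact: act_nondegenerate (mate_nondegenerate rt) (@coface_inj _ j).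
move=> t' rt' [e|e]; first by rewrite -e; apply: w_face => //; rewrite e.
by apply: w_dim => //; have := congr1 tag e => /= ->.
Qed.

Lemma face_mate_red n (t t' : X n) (f : dmap n n.+1) :
  red (Tagged (spx X) t) -> red (Tagged (spx X) t') ->
  w (Tagged (spx X) t') <= w (Tagged (spx X) t) ->
  t = sact f (mate M t') -> t = t'.
Proof.
move=> rt rt' wtt' e.
have [j fj] : exists j, f = coface j.
  by apply: dmap_inj_coface; apply: (@nondegenerate_inj _ _ _ (mate M t')); rewrite -e;
    exact: red_nondegenerate rt.
have [ji|ji] := pselect (j = idx M t'); first by rewrite (red_face rt') -ji e fj.
have := w_face rt' ji; rewrite /face -fj -e => /(_ rt).
by rewrite ltnNge wtt'.
Qed.

(** If t lay in the mate of a lighter t', then [w_dim] would exclude dim t < dim t', [face_mate_red]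
    would give t = t' in equal dimensions, and otherwise t would be that mate, which is
    collapsible. *)
Lemma red_not_stage t : red t -> ~ stage (w t) t.
Proof.
case: t => n t rt [[f /= e]|[[n' t'] [rt' wt' [f /= e]]]].
  have fi : injective f.
    by apply: (@nondegenerate_inj _ _ _ v); rewrite -e; exact: red_nondegenerate rt.
  have n0 : n = 0 by apply/eqP; rewrite -leqn0; exact: dmap_inj_leq fi.
  subst n; move: matchM => [[_ /seteqP[h _] _ _] _ _].
  apply: (h (Tagged (spx X) t)); split=> //.
  by rewrite critE e (dmap_inj_id fi) sact_id.
have fi : injective f.
  by apply: (@nondegenerate_inj _ _ _ (mate M t')); rewrite -e;
    exact: red_nondegenerate rt.
have nn' := dmap_inj_leq fi; have [n'n|n'n] := ltnP n n'.
  by have := w_dim rt rt' n'n; rewrite ltnNge (ltnW wt').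
have [en|en] : n = n' \/ n = n'.+1 by move: nn' n'n => /=; lia.
  subst n'; have et := face_mate_red rt rt' (ltnW wt') e.
  by move: wt'; rewrite et ltnn.
subst n; apply: (red_coll rt); rewrite e (dmap_inj_id fi) sact_id.
exact: (mate_coll rt').
Qed.

(** The part of the mate that is new at its stage is its interior together with the interior of the
    redundant face. *)
Lemma stage_avoid m n (t : X n) (f : dmap m n.+1) : red (Tagged (spx X) t) ->
  ~ stage (w (Tagged (spx X) t)) (Tagged (spx X) (sact f (mate M t))) <->
  (forall j, j != idx M t -> exists i, f i = j).
Proof.
move=> rt; split=> [nst j jt|fh st].
  apply: contrapT => fj; apply: nst.
  have [|u ->] := @dmap_avoid _ _ f j; first by move=> i; apply: contra_notN fj =>
    /eqP <-; exists i.
  by rewrite sact_comp; apply: stage_act; exact: stage_face.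
have [|s sE] := dmap_section (@coface_inj _ (idx M t)) (f := f).
  by move=> k; apply: fh; rewrite mk_dmapE eq_sym neq_lift.
apply: (red_not_stage rt); have := stage_act s st.
by rewrite -sact_comp sE -/(face _ _) -red_face.
Qed.

(** Makes a definition by cases on the new simplices unambiguous: equal weights force equal
    dimensions, the redundant face inside x identifies t, and the vertex labels identify f. *)
Lemma stage_unique m (x : X m) (t t' : simplex X)
    (f : dmap m (tag t).+1) (f' : dmap m (tag t').+1) :
  red t -> red t' -> w t = w t' -> ~ stage (w t) (Tagged (spx X) x) ->
  x = sact f (mate M (tagged t)) -> x = sact f' (mate M (tagged t')) ->
  existT (fun t : simplex X => dmap m (tag t).+1) t f = existT _ t' f'.
Proof.
case: t t' f f' => [n t] [n' t'] /= f f' rt rt' ww nst e e'.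
have nn' : n = n'.
  have := @w_dim _ _ rt rt'; have := @w_dim _ _ rt' rt; rewrite ww ltnn /=.
  by have [] := ltngtP n n' => // _; [move=> _ /(_ isT)|move=> /(_ isT)].
subst n'; move: nst; rewrite e stage_avoid// => fh.
have [|s sE] := dmap_section (@coface_inj _ (idx M t)) (f := f).
  by move=> k; apply: fh; rewrite mk_dmapE eq_sym neq_lift.
have et : t = sact (dcomp f' s) (mate M t').
  by rewrite sact_comp -e' e -sact_comp sE; exact: red_face.
have {}et : t = t' by apply: face_mate_red rt rt' _ et; rewrite ww.
subst t'; congr existT; apply: dmapP => i.
by apply: (rk_inj (mate_nondegenerate rt)); rewrite -!rk_act /= -e -e'.
Qed.

(** * Extending the contraction one stage at a time *)

Section Homotopy.
Variable R : realType.
Local Open Scope ring_scope.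
Local Notation T := (realization R X).
Local Notation homotopy := (forall n, X n -> R -> std_simplex R n -> T).

(** Time runs from [- k] to [0], so that a homotopy defined on one stage is kept
    unchanged on the next one. *)
Definition contraction (a : T) k (h : homotopy) :=
  forall n (x : X n), stage k (Tagged (spx X) x) ->
  [/\ continuous (fun z : R * std_simplex R n => h n x z.1 z.2),
      forall m (f : dmap m n) s p, h m (sact f x) s p = h n x s (push f p),
      forall s p, s <= - k%:R -> h n x s p = rpoint x p &
      forall s p, 0 <= s -> h n x s p = a].

(** Stage 0 consists of v and its degeneracies, which realize to a single point. *)
Lemma contraction0 p0 : contraction (rpoint v p0) 0 (fun n x _ p => rpoint x p).
Proof.
move=> n x [[f /= e]|[t [_]]]; last by rewrite ltn0.
split=> //.
- move=> z; apply: (@continuous_comp _ _ _ snd (rpoint x)); first exact: cvg_snd.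
  exact: rpoint_continuous.
- by move=> m g s p; exact: rpoint_act.
move=> s p _; rewrite e rpoint_act; congr rpoint; apply: baryP => i.
by rewrite ord1; have := bary_sum (push f p); have := bary_sum p0; rewrite !big_ord1 =>
  -> ->.
Qed.

Section Step.
Variables (a : T) (k : nat) (h : homotopy).
Hypothesis hP : contraction a k h.

(** From time - k - 1 to - k the point slides off the redundant face onto some face j; from then on
    it follows the old homotopy [h] there. The face is entered through [squash], which keeps all
    coordinates of the point. Some j always exists, so the final [a] is only a default. *)
Definition cell_homotopy n (t : X n) (s : R) (p : std_simplex R n.+1) : T :=
  let i := idx M t in
  if s <= - k%:R then rpoint (mate M t) (slide i (s + k%:R + 1) p) else
  if [pick j | (j != i) && (bary (slide i 1 p) j == 0)] is Some j
  then h (sact (squash i j) (mate M t)) s (slide i 1 p) else a.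

Variables (n : nat) (t : X n).
Hypotheses (rt : red (Tagged (spx X) t)) (wt : w (Tagged (spx X) t) = k).
Local Notation i := (idx M t).

Lemma stage_squash j : j != i ->
  stage k (Tagged (spx X) (sact (squash i j) (mate M t))).
Proof.
move=> ji; have [|u ->] := @dmap_avoid _ _ (squash i j) j.
  by move=> l; exact: squash_avoid.
by rewrite sact_comp; apply: stage_act; rewrite -wt; exact: stage_face.
Qed.

(** A point on two faces may follow either: both agree with [h] on the image of a map avoiding both
    vertices, which [squash2] provides and which fixes the point. *)
Lemma homotopy_squash j l s p : j != i -> l != i ->
  bary p j = 0 -> bary p l = 0 ->
  h (sact (squash i j) (mate M t)) s p = h (sact (squash i l) (mate M t)) s p.
Proof.
move=> ji li pj pl; have [f [fj fl ff]] := squash2 ji li.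
have fp : push f p = p.
  by apply: push_support => b; have [->|bj] := eqVneq b j; [rewrite pj eqxx|
    have [->|bl _] := eqVneq b l; [rewrite pl eqxx|exact: ff]].
have sq b : b != i -> (forall c, f c != b) ->
    h (sact (squash i b) (mate M t)) s p = h (sact f (mate M t)) s p.
  move=> bi fb; have [_ hE _ _] := hP (stage_squash bi).
  by rewrite -[in LHS]fp -hE -sact_comp squash_comp.
by rewrite sq// sq.
Qed.

Lemma cell_homotopy_late j s p : j != i -> - k%:R <= s ->
  bary (slide i 1 p) j = 0 ->
  cell_homotopy t s p = h (sact (squash i j) (mate M t)) s (slide i 1 p).
Proof.
move=> ji ks pj; rewrite /cell_homotopy; case: ifPn => [sk|_].
  have [_ _ -> // _] := hP (stage_squash ji).
  (* The two phases meet at time - k, when [h] has not yet moved the point. *)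
  have -> : s = - k%:R by apply: le_anti; rewrite sk ks.
  rewrite addNr add0r rpoint_act push_support// => b pb.
  by apply: squashE; apply: contraNneq pb => ->; rewrite pj.
case: pickP => [l /andP[li /eqP pl]|/(_ j)]; first exact: homotopy_squash.
by rewrite ji pj eqxx.
Qed.

(** Points on the old faces do not slide, and [h] is at rest until time - k, so the new homotopy
    extends the old one. *)
Lemma cell_homotopy_face j s p : j != i -> bary p j = 0 ->
  cell_homotopy t s p = h (sact (squash i j) (mate M t)) s p.
Proof.
move=> ji pj; have [ks|sk] := leP (- k%:R) s.
  by rewrite (cell_homotopy_late ji ks) ?(slide_face _ ji pj).
rewrite /cell_homotopy (ltW sk) (slide_face _ ji pj).
have [_ _ hs _] := hP (stage_squash ji).
rewrite hs ?(ltW sk)// rpoint_act push_support// => b pb.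
by apply: squashE; apply: contraNneq pb => ->; rewrite pj.
Qed.

Let off : exists j, j != i.
Proof.
by exists (lift i ord0); rewrite eq_sym neq_lift.
Qed.

Lemma cell_homotopy_start s p : s <= - k.+1%:R ->
  cell_homotopy t s p = rpoint (mate M t) p.
Proof.
rewrite -natr1 => ks; rewrite /cell_homotopy slide0; last by lra.
by rewrite ifT//; lra.
Qed.

Lemma cell_homotopy_end s p : 0 <= s -> cell_homotopy t s p = a.
Proof.
move=> s0; have [j0 j0i] := off; have [j ji pj] := slide1 p j0i.
rewrite (cell_homotopy_late ji _ pj).
  by have [_ _ _ ->] := hP (stage_squash ji).
by rewrite (le_trans _ s0)// oppr_le0.
Qed.

Lemma cell_homotopy_continuous :
  continuous (fun z : R * std_simplex R n.+1 => cell_homotopy t z.1 z.2).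
Proof.
have c1 : continuous (fun z : R * std_simplex R n.+1 => slide i 1 z.2).
  apply: (continuous_curry2 (@slide_continuous R _ i)) => z;
    [exact: cvg_cst|exact: cvg_snd].
(* The closed cover has one piece [None] for the sliding phase, and for each j the later times at
   which coordinate j vanishes after the slide. The piece for j = i is empty, so the value of [g]
   there is arbitrary. *)
pose K (j : option 'I_n.+2) := if j is Some j then
    [set z : R * std_simplex R n.+1 | [/\ j != i, - k%:R <= z.1 & bary (slide i 1 z.2) j
      = 0]]
  else [set z | z.1 <= - k%:R].
pose g (j : option 'I_n.+2) (z : R * std_simplex R n.+1) : T :=
  if j is Some j then
    if j == i then a else h (sact (squash i j) (mate M t)) z.1 (slide i 1 z.2)
  else rpoint (mate M t) (slide i (z.1 + k%:R + 1) z.2).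
apply: (@continuous_closed_cover _ _ _ K g).
- case=> [j|] /=; last first.
    by apply: (@preimage_closed _ _ fst [set s : R | s <= - k%:R]) => [z _|];
      [exact: cvg_fst|exact: closed_le].
  have [ji|ji] := boolP (j == i).
    rewrite (_ : [set _ | _] = set0); first exact: closed0.
    by apply/seteqP; split=> // z [].
  rewrite (_ : [set _ | _] = [set z | - k%:R <= z.1] `&` [set z | bary (slide i 1 z.2) j
    = 0]).
    apply: closedI.
      by apply: (@preimage_closed _ _ fst [set s : R | - k%:R <= s]) => [z _|];
        [exact: cvg_fst|exact: closed_ge].
    apply: (@preimage_closed _ _ (fun z : R * std_simplex R n.+1 =>
      bary (slide i 1 z.2) j) [set s : R | s = 0]) => [z _|]; last exact: closed_eq.
    by apply: (@continuous_comp _ _ _ (fun z : R * std_simplex R n.+1 =>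
      slide i 1 z.2) (fun p => bary p j)); [exact: c1|exact: bary_continuous].
  by apply/seteqP; split=> z [].
- case=> [j|]; rewrite /g /=.
    have [ji|ji] := boolP (j == i); first exact: cst_continuous.
    have [ch _ _ _] := hP (stage_squash ji).
    by apply: (continuous_curry2 ch _ c1) => z; exact: cvg_fst.
  move=> z; apply: (@continuous_comp _ _ _ (fun z : R * std_simplex R n.+1 =>
    slide i (z.1 + k%:R + 1) z.2) (rpoint (mate M t))); last exact: rpoint_continuous.
  apply: (continuous_curry2 (@slide_continuous R _ i)) => {}z; last exact: cvg_snd.
  by apply: cvgD; [apply: cvgD; [exact: cvg_fst|exact: cvg_cst]|exact: cvg_cst].
- move=> [j|] z /= => [[ji ks pj]|]; last by rewrite /cell_homotopy => ->.
  by rewrite (negPf ji); exact: cell_homotopy_late.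
move=> z; have [ks|ks] := leP z.1 (- k%:R); first by exists None.
have [j0 j0i] := off; have [j ji pj] := slide1 z.2 j0i.
by exists (Some j); split=> //; exact: ltW.
Qed.

End Step.

Lemma contraction_step a k h : contraction a k h ->
  exists h', contraction a k.+1 h'.
Proof.
move=> hP.
(* A new simplex is presented by a redundant cell of weight k and a map into its mate; by
   [stage_unique] the presentation is unique, so the values in [spec] are well defined. *)
pose new n (x : X n) (u : {t : simplex X & dmap n (tag t).+1}) :=
  [/\ red (tag u), w (tag u) = k & x = sact (tagged u) (mate M (tagged (tag u)))].
pose spec n (x : X n) (hx : R -> std_simplex R n -> T) :=
  (stage k (Tagged (spx X) x) -> hx = h n x) /\
  (~ stage k (Tagged (spx X) x) -> forall u, new n x u ->
    hx = fun s p => cell_homotopy a k h (tagged (tag u)) s (push (tagged u) p)).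
have ex n (x : X n) : exists hx, spec n x hx.
  have [st|nst] := pselect (stage k (Tagged (spx X) x)); first by exists (h n x).
  have [[u [ru wu eu]]|nu] := pselect (exists u, new n x u); last first.
    by exists (h n x); split=> // _ u uP; case: nu; exists u.
  exists (fun s p => cell_homotopy a k h (tagged (tag u)) s (push (tagged u) p)).
  split=> // _ [t' f'] [rt' wt' et'].
  suff -> : u = existT _ t' f' by [].
  case: u ru wu eu => t f /= rt wt et.
  by apply: stage_unique et et'; rewrite // wt.
pose h' n (x : X n) := sval (cid (ex n x)).
have h'old n (x : X n) : stage k (Tagged (spx X) x) -> h' n x = h n x.
  by move=> st; have [+ _] := svalP (cid (ex n x)); apply.
have h'new m n (t : X n) (f : dmap m n.+1) (x : X m) :
    ~ stage k (Tagged (spx X) x) -> red (Tagged (spx X) t) -> w (Tagged (spx X) t) = k ->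
    x = sact f (mate M t) ->
    h' m x = fun s p => cell_homotopy a k h t s (push f p).
  move=> nst rt wt e; have [_ /(_ nst (existT _ (Tagged (spx X) t) f))] :=
    svalP (cid (ex m x)).
  by apply.
exists h' => n x sx.
have [st|nst] := pselect (stage k (Tagged (spx X) x)).
  have [c hE h0 h1] := hP _ _ st; rewrite h'old//; split=> //.
    move=> m f s p; rewrite h'old//; exact: stage_act.
  move=> s p ks; apply: h0; apply: le_trans ks _.
  by rewrite lerN2 ler_nat.
have [[q t] [/= rt wt [f /= e]]] : exists t, [/\ red t,
  w t = k & acts_from (mate_simplex M t) (Tagged (spx X) x)].
  case: sx => [sv|[t [rt wt tx]]]; first by case: nst; left.
  exists t; split=> //; move: wt; rewrite ltnS leq_eqVlt => /predU1P[//|wt].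
  by case: nst; right; exists t.
rewrite (h'new _ _ _ _ _ nst rt wt e); split.
- apply: (continuous_curry2 (cell_homotopy_continuous hP rt wt)) => z;
  first exact: cvg_fst.
  apply: (@continuous_comp _ _ _ snd (push f)); [exact: cvg_snd|exact: push_continuous].
- move=> m g s p; have eg : sact g x = sact (dcomp f g) (mate M t) by rewrite e sact_comp.
  have [stg|nstg] := pselect (stage k (Tagged (spx X) (sact g x))); last first.
    by rewrite (h'new _ _ _ _ _ nstg rt wt eg) push_comp.
  (* If acting on a new simplex leads back to the old stage, some vertex j other than [idx M t] is
     missed by [stage_avoid], and on the face j the formula agrees with [h]. *)
  have [j ji fj] : exists2 j, j != idx M t & forall i, dcomp f g i != j.
    apply: contrapT => hj; have := stage_avoid (dcomp f g) rt; rewrite wt -eg => -[_ +].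
    apply; last exact: stg; move=> j ji; apply: contrapT => hi; apply: hj.
    by exists j => // i; apply: contra_notN hi => /eqP hi; exists i.
  have fgj : dcomp (squash (idx M t) j) (dcomp f g) = dcomp f g by exact: squash_comp.
  have [_ hE _ _] := hP _ _ (stage_squash rt wt ji).
  rewrite h'old// eg -[in LHS]fgj sact_comp hE.
  rewrite -push_comp (cell_homotopy_face hP rt wt _ ji)// bary_push big1// => i /eqP ij.
  by have := fj i; rewrite ij eqxx.
- move=> s p ks; rewrite cell_homotopy_start//.
  by rewrite e rpoint_act.
- by move=> s p s0; rewrite (cell_homotopy_end hP).
Qed.

Lemma simplex_act_cell n (x : X n) :
  exists y : simplex X, Defs.nondegenerate (tagged y) /\ acts_from y (Tagged (spx X) x).
Proof.
elim: n x => [|n IH] x.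
  by exists (Tagged (spx X) x); split=> //; exists (did 0); rewrite sact_id.
have [nx|] := pselect (Defs.nondegenerate x).
  by exists (Tagged (spx X) x); split=> //; exists (did _); rewrite sact_id.
move=> /existsNP[j /existsNP[y /contrapT ->]].
have [z [nz [f /= e]]] := IH y; exists z; split=> //.
by exists (dcomp f (codegen j)); rewrite /= sact_comp -e.
Qed.

Lemma matching_contractible : (exists K, forall t, red t -> (w t < K)%N) ->
  sset_contractible R X.
Proof.
move=> [K wK].
have st n (x : X n) : stage K (Tagged (spx X) x).
  have [[q y] [ny [f /= ->]]] := simplex_act_cell x; apply: stage_act.
  by apply: stage_cell => // t rt _; exact: wK.
have p0 : std_simplex R 0.
  exists (const_mx 1); apply/mem_set; split=> [i|]; first by rewrite mxE.
  by rewrite big_ord1 mxE.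
pose a : T := rpoint v p0.
have [h hP] : exists h, contraction a K h.
  elim: K {wK st} => [|k [h hP]]; first by eexists; exact: contraction0.
  exact: contraction_step hP.
have [H cH HE] : exists2 H : R * realization R X -> T, continuous H &
    forall n (x : X n) s p, H (s, rpoint x p) = h n x s p.
  apply: realization_homotopy => [n x|m n f x s p].
    by have [] := hP _ _ (st n x).
  by have [_ hE _ _] := hP _ _ (st _ x); exact: hE.
(* The interval from 0 to 1 is rescaled to the one from - K to 0. *)
exists a, (fun z => H (z.1 * K%:R - K%:R, z.2)); split.
- apply: continuous_subspaceT; apply: (continuous_curry2 (h := fun s z => H (s, z))).
  + by rewrite (_ : (fun z => _) = H)//; apply/funext => -[].
  + by move=> z; apply: cvgB; [apply: cvgM; [exact: cvg_fst|exact: cvg_cst]|exact: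
    cvg_cst].
  + by move=> z; exact: cvg_snd.
- move=> z /=; have [n [x [p ->]]] := realizationP z.
  by rewrite HE; have [_ _ -> //] := hP _ _ (st n x); rewrite mul0r sub0r.
- move=> z /=; have [n [x [p ->]]] := realizationP z.
  by rewrite HE; have [_ _ _ -> //] := hP _ _ (st n x); rewrite mul1r subrr.
Qed.

End Homotopy.

End Matching.
End Ranked.

(** * The matching on the orbit space *)

Section OrbitSpace.
Local Open Scope nat_scope.
Variables (gT : finGroupType) (p : nat) (S : {group gT}) (F : fusion_system S).
Variable C : fcollection F.
Hypotheses (pS : (p.-group S)%g) (satF : saturated F p) (closedC : fclosed_coll C).
Local Notation X := (quotient_nerve C).

Lemma receptive_rep_ex n (x : X n) :
  exists P : chain C n, receptive_chain P /\ chain_class P = x.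
Proof.
have [Q ->] := chain_class_surj x.
have [P QP rP] := exists_receptive_chain Q pS satF.
by exists P; split=> //; apply/esym/chain_class_eq.
Qed.

Definition receptive_rep n (x : X n) : chain C n := sval (cid (receptive_rep_ex x)).

Lemma receptive_repP n (x : X n) : receptive_chain (receptive_rep x).
Proof. by rewrite /receptive_rep; case: cid => ? []. Qed.

Lemma receptive_repK n (x : X n) : chain_class (receptive_rep x) = x.
Proof. by rewrite /receptive_rep; case: cid => ? []. Qed.

Lemma receptive_rep_rel n (P : chain C n) : chain_rel (receptive_rep (chain_class P)) P.
Proof. by apply: chain_class_rel; rewrite receptive_repK. Qed.

Definition rank n (x : X n) (i : 'I_n.+1) : nat := #|receptive_rep x i|.

Lemma rank_class n (P : chain C n) i : rank (chain_class P) i = #|P i|.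
Proof. exact: chain_rel_card (receptive_rep_rel P). Qed.

Lemma rank_act m n (f : dmap m n) (x : X n) i : rank (sact f x) i = rank x (f i).
Proof. by rewrite -(receptive_repK x) chain_class_act !rank_class chain_actE. Qed.

(** If the orders at i < j agree, then P_i = P_{i+1} in the representative, and x is the degeneracy
    at i of its face i + 1. *)
Lemma rank_lt n (x : X n) : Defs.nondegenerate x ->
  forall i j : 'I_n.+1, i < j -> rank x i < rank x j.
Proof.
case: n x => [|n] x; first by move=> _ i j; rewrite !ord1.
move=> nx i j ij; rewrite ltnNge; apply/negP => ji; set P := receptive_rep x.
have lt_in : i < n.+1 by apply: leq_trans ij _; rewrite -ltnS.
pose k := Ordinal lt_in; pose k1 : 'I_n.+2 := lift ord0 k.
have Pik : P i = P k1.
  have Pij : P i = P j.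
    by apply/group_inj/eqP; rewrite finset.eqEcard ji chain_homo// ltnW.
  apply/group_inj/eqP; rewrite finset.eqEsubset; apply/andP; split.
    by apply: chain_homo; rewrite /= /bump /=; lia.
  by rewrite Pij; apply: chain_homo; rewrite /= /bump /=; lia.
apply: (nx k (face k1 x)); rewrite /degen /face -[x]receptive_repK -/P !chain_class_act.
congr chain_class; apply: chainP => l; rewrite !chain_actE !mk_dmapE.
have [lk|lk] := eqVneq l k1.
  rewrite lk -Pik; congr (P _); apply: ord_inj.
  by rewrite /= /bump /unbump /=; lia.
congr (P _); apply: ord_inj; move: lk; rewrite -(inj_eq val_inj).
by rewrite /= /bump /unbump /=; lia.
Qed.

Definition class_index n (x : X n) : 'I_n.+1 := normal_index (receptive_rep x).

Lemma class_index_class n (P : chain C n) : class_index (chain_class P) = normal_index P.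
Proof. exact: normal_index_rel (receptive_rep_rel P). Qed.

Definition tight n (x : X n) : bool :=
  new_group (receptive_rep x) == receptive_rep x (class_index x).

Definition orbit_morse_data : morse_data X := {|
  critical_cells := [set z : simplex X | [/\ Defs.nondegenerate (tagged z),
    tight (tagged z) & class_index (tagged z) = ord0]]%classic;
  redundant_cells := [set z : simplex X | Defs.nondegenerate (tagged z) /\ ~~ tight
    (tagged z)]%classic;
  collapsible_cells := [set z : simplex X | [/\ Defs.nondegenerate (tagged z),
    tight (tagged z) & class_index (tagged z) != ord0]]%classic;
  mate := fun n (x : X n) => chain_class (insert closedC (receptive_rep x));
  idx := fun n (x : X n) => pivot (receptive_rep x) |}.

Local Notation M := orbit_morse_data.

Lemma face_mate n (x : X n) : x = face (idx M x) (mate M x).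
Proof.
rewrite /face -[mate M x]/(chain_class (insert closedC (receptive_rep x))).
by rewrite chain_class_act face_insert receptive_repK.
Qed.

Lemma mate_nondeg n (x : X n) : Defs.nondegenerate x -> ~~ tight x ->
  Defs.nondegenerate (mate M x).
Proof.
move=> nx tx; apply: (rk_nondegenerate rank_act) => i j; rewrite !rank_class.
by apply: insert_strict => //; exact: rank_lt.
Qed.

Lemma mate_tight n (x : X n) :
  tight (mate M x) /\ class_index (mate M x) = pivot (receptive_rep x).
Proof.
have [e1 e2] := insert_tight (@receptive_repP _ x) (receptive_rep_rel (insert closedC
  (receptive_rep x))).
by split=> //; apply/eqP.
Qed.

Lemma orbit_bij : set_bij (redundant_cells M) (collapsible_cells M) (mate_simplex M).
Proof.
split.
- move=> [n x] /= [nx tx]; have [tm fm] := mate_tight x.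
  by split=> //; [exact: mate_nondeg|rewrite fm].
(* Deleting the entry at the normal index undoes the insertion. The value on vertices is arbitrary,
   since a mate has positive dimension. *)
- pose back (z : simplex X) : simplex X :=
    match z with
    | existT 0 y => Tagged (spx X) y
    | existT m.+1 y => Tagged (spx X) (face (class_index y) y)
    end.
  have backK z : back (mate_simplex M z) = z.
    case: z => n x; rewrite /mate_simplex /= -/(mate M x).
    by have [_ ->] := mate_tight x; congr existT; exact/esym/face_mate.
  by move=> z z' _ _ /(congr1 back); rewrite !backK.
(* For surjectivity, [tight_insert] is applied to the receptive representatives of y and of its face
   at the normal index. *)
- move=> [[|n] y] [/= + ty fy]; first by case/eqP: fy; rewrite ord1.
  rewrite -[X in X -> _]/(Defs.nondegenerate y) => ny.
  pose x : X n := face (class_index y) y.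
  have RR : chain_rel (receptive_rep x) (chain_act (coface (class_index y))
    (receptive_rep y)).
    by apply: chain_class_rel; rewrite receptive_repK -chain_class_act receptive_repK.
  have [nt RI] := tight_insert closedC pS (rank_lt ny) (@receptive_repP _ y)
    (@receptive_repP _ x) (eqP ty) fy RR.
  exists (Tagged (spx X) x) => /=.
    split=> //; exact: (act_nondegenerate rank_act rank_lt ny (@coface_inj _ _)).
  congr existT; rewrite /= -(chain_class_eq RI); exact: receptive_repK.
Qed.

Lemma orbit_matching :
  [/\ [/\ critical_cells M `|` redundant_cells M `|` collapsible_cells M = @cells X,
          critical_cells M `&` redundant_cells M = set0,
          critical_cells M `&` collapsible_cells M = set0 &
          redundant_cells M `&` collapsible_cells M = set0],
      set_bij (redundant_cells M) (collapsible_cells M) (mate_simplex M) &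
      forall n (t : X n), redundant_cells M (Tagged (spx X) t) ->
        t = face (idx M t) (mate M t)]%classic.
Proof.
split; [split|exact: orbit_bij|by move=> n t _; exact: face_mate].
- apply/seteqP; split=> z /=; first by case=> [[]|] [].
  move=> nz; have [tz|tz] := boolP (tight (tagged z)); last by left; right.
  have [fz|fz] := eqVneq (class_index (tagged z)) ord0; [by left; left|by right].
- by apply/seteqP; split=> z // [[_ tz _] [_]]; rewrite tz.
- by apply/seteqP; split=> z // [[_ _ fz] [_ _]]; rewrite fz eqxx.
- by apply/seteqP; split=> z // [[_ tz] [_ tz']]; rewrite tz' in tz.
Qed.

(** * The weight of a cell and its decrease along face edges *)

Lemma rank_le n (x : X n) i : rank x i <= #|S|.
Proof. by apply: subset_leq_card; exact: chain_sub. Qed.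

(** The orders increase strictly along the chain, starting from at least 1. *)
Lemma dim_lt n (x : X n) : Defs.nondegenerate x -> n < #|S|.
Proof.
move=> nx; suff H k (kn : k < n.+1) : k < rank x (Ordinal kn).
  exact: leq_trans (H n (ltnSn n)) (rank_le _ _).
elim: k kn => [|k IH] kn; first exact: cardG_gt0.
by apply: leq_ltn_trans (IH (ltnW kn)) _; exact: rank_lt.
Qed.

Definition total_rank n (x : X n) : nat := \sum_i rank x i.

Lemma total_rank_le n (x : X n) : Defs.nondegenerate x -> total_rank x <= #|S| * #|S|.
Proof.
move=> nx; apply: leq_trans (_ : \sum_(i < n.+1) #|S| <= _).
  by apply: leq_sum => i _; exact: rank_le.
by rewrite sum_nat_const card_ord leq_mul2r (dim_lt nx) orbT.
Qed.

(** Along a face edge of the digraph, the dimension decreases, or the normal part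
    gets longer, or the subgroups get larger; the weight encodes this
    lexicographic order. *)
Definition weight (z : simplex X) : nat :=
  (tag z * #|S|.+1 + (#|S| - class_index (tagged z))) * (#|S| * #|S|).+1
  + (#|S| * #|S| - total_rank (tagged z)).

(** A larger leading digit in base L + 1 outweighs any last digit. *)
Lemma lex_lt (L a a' c c' : nat) : a < a' -> c <= L -> a * L.+1 + c < a' * L.+1 + c'.
Proof.
by move=> aa cL; have := leq_mul aa (leqnn L.+1); rewrite mulSn; lia.
Qed.

Lemma weight_dim z z' : tag z < tag z' -> weight z < weight z'.
Proof. by move=> zz; apply: lex_lt; rewrite ?leq_subr// lex_lt// leq_subr. Qed.

Lemma weight_face n (x : X n) (j : 'I_n.+2) : Defs.nondegenerate x -> ~~ tight x ->
  j <> idx M x ->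
  weight (Tagged (spx X) (face j (mate M x))) < weight (Tagged (spx X) x).
Proof.
move=> nx tx jx; set y := face j (mate M x); set P := receptive_rep x.
have ny : Defs.nondegenerate y.
  exact: (act_nondegenerate rank_act rank_lt (mate_nondeg nx tx) (@coface_inj _ j)).
pose D := chain_act (coface j) (insert closedC P).
have yE : y = chain_class D.
  by rewrite /y /face -[mate M x]/(chain_class (insert closedC P)) chain_class_act.
have DE k : D k = insert closedC P (lift j k) by rewrite chain_actE mk_dmapE.
have iN := insert_normal_upto closedC P.
have bS := dim_lt nx.
have fE : class_index y = normal_index D by rewrite yE class_index_class.
(* Below the pivot some P_j with j at most i is deleted: the index does not drop, and the total
   order grows because the larger new group has come in. Above the pivot the new group survives and
   the index rises. *)
have [jlt|jgt|/ord_inj je] := ltngtP j (pivot P); last by case: jx.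
  have iD : normal_index P <= normal_index D.
    rewrite leq_normal_index; apply/normal_uptoP => k kP; rewrite !DE.
    have /normal_uptoP h : normal_upto (insert closedC P) (lift j (normal_index P)).
      by apply: normal_upto_leq iN; rewrite /= /bump /=; lia.
    by apply: h; rewrite leq_bump2.
  have sD : total_rank x < total_rank y.
    have sumE (k : 'I_n.+2) (x' : X n) : x' = face k (mate M x) ->
        total_rank x' = \sum_(i < n.+1) #|insert closedC P (lift k i)|.
      move=> ->; apply: eq_bigr => i _.
      rewrite /face -[mate M x]/(chain_class (insert closedC P)) chain_class_act
        rank_class.
      by rewrite chain_actE mk_dmapE.
    have tot k : #|insert closedC P k| + \sum_(i < n.+1) #|insert closedC P (lift k i)| =
        \sum_i #|insert closedC P i| by rewrite [RHS](bigD1_ord k).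
    (* Both x and y omit one entry of the same insertion, so omitting the smaller entry leaves the
       larger sum. *)
    suff : #|insert closedC P j| < #|insert closedC P (idx M x)|.
      by move: (tot j) (tot (idx M x)); rewrite (sumE _ _ (face_mate x)) (sumE j y)//;
        lia.
    rewrite insert_pivot; apply: leq_ltn_trans (new_group_strict tx).
    have [k jE kP] : exists2 k : 'I_n.+1, j = lift (pivot P) k & k <= normal_index P.
      case: (unliftP (pivot P) j) jlt => [k|] ->; last by rewrite ltnn.
      by exists k => //; apply: sub_lift_pivot; exact: ltnW.
    by rewrite jE insert_lift; apply: subset_leq_card; exact: chain_homo.
  have syS := total_rank_le ny.
  rewrite /weight /= fE; move: iD; rewrite leq_eqVlt => /predU1P[<-|iD].
    by rewrite -/(class_index x) ltn_add2l ltn_sub2l//; exact: leq_trans sD syS.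
  apply: lex_lt; last exact: leq_subr.
  by rewrite ltn_add2l ltn_sub2l//; apply: leq_ltn_trans bS; rewrite -ltnS.
have jn : pivot P < n.+1 by apply: leq_trans jgt _; rewrite -ltnS.
have iD : (normal_index P).+1 <= normal_index D.
  rewrite -[_.+1]/(nat_of_ord (Ordinal jn)) leq_normal_index.
  apply/normal_uptoP => k kP; rewrite !DE.
  have /normal_uptoP h : normal_upto (insert closedC P) (lift j (Ordinal jn)).
    by apply: normal_upto_leq iN; move: jgt; rewrite /= /bump /=; lia.
  by apply: h; rewrite leq_bump2.
rewrite /weight /= fE.
apply: lex_lt; last exact: leq_subr.
by rewrite ltn_add2l ltn_sub2l//; apply: leq_ltn_trans bS; rewrite -ltnS.
Qed.

Lemma weight_bound (z : simplex X) : Defs.nondegenerate (tagged z) ->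
  weight z < (#|S| * #|S|.+1) * (#|S| * #|S|).+1.
Proof.
move=> nz; rewrite -[X in _ < X]addn0; apply: lex_lt; last exact: leq_subr.
have := dim_lt nz; case: z nz => n x /= _ nS.
by rewrite -[X in _ < X]addn0; apply: lex_lt; rewrite ?leq_subr.
Qed.

(** S belongs to a non-empty closed collection, and [tight0] shows that a critical cell is the class
    of the chain (S). *)
Lemma orbit_critical : (exists P, P \in fcoll C) ->
  exists v : X 0, critical_cells M = [set Tagged (spx X) v]%classic.
Proof.
move=> [P0 CP0]; have CS : S \in fcoll C by exact: closedC CP0 (fcoll_sub CP0) _.
have SP : [forall i, [ffun _ : 'I_1 => S] i \in fcoll C] &&
    [forall i : 'I_1, forall j : 'I_1, (i <= j) ==>
      ([ffun _ : 'I_1 => S] i \subset [ffun _ : 'I_1 => S] j)].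
  by apply/andP; split; apply/forallP => i; [|apply/forallP => j];
    rewrite !ffunE ?subxx ?implybT.
pose cS : chain C 0 := Sub [ffun _ : 'I_1 => S] SP.
have cSE i : cS i = S by rewrite /chain_fun /= ffunE.
exists (chain_class cS); apply/seteqP; split=> [[n x] [/= nx /eqP tx fx]|_ ->].
  have [n0 PS] := tight0 pS (rank_lt nx) tx fx; subst n.
  congr existT; rewrite -[x]receptive_repK; congr chain_class.
  by apply: chainP => i; rewrite cSE ord1 PS.
split=> //=; last by rewrite ord1.
apply/eqP/tight_leq; apply: leq_trans (subset_leq_card (new_group_sub _)) _.
by rewrite -/(rank _ _) rank_class cSE.
Qed.

End OrbitSpace.

Theorem theorem4p6 (R : realType) (gT : finGroupType) (p : nat)
    (S : {group gT}) (F : fusion_system S) (C : fcollection F) :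
  prime p -> (p.-group S)%g -> saturated F p ->
  fclosed_coll C -> (exists P, P \in fcoll C) ->
  (exists M : morse_data (quotient_nerve C),
      morse_matching M /\
      exists v : quotient_nerve C 0,
        critical_cells M = [set Tagged (spx (quotient_nerve C)) v]%classic) /\
  sset_contractible R (quotient_nerve C).
Proof.
move=> _ pS satF closedC neC.
have [v vE] := orbit_critical pS satF closedC neC.
have matching := orbit_matching pS satF closedC.
set M := orbit_morse_data pS satF closedC in vE matching *.
(* One weight serves twice: it excludes infinite paths and it orders the cells for the
   contraction. *)
have w_dim t t' : redundant_cells M t -> redundant_cells M t' ->
    (tag t < tag t')%N -> (weight pS satF t < weight pS satF t')%N.
  by move=> _ _; exact: weight_dim.
have w_face n (t : quotient_nerve C n) j : redundant_cells M (Tagged (spx (quotient_nerve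
  C)) t) ->
    j <> idx M t -> redundant_cells M (Tagged (spx (quotient_nerve C)) (face j (mate M
      t))) ->
    (weight pS satF (Tagged (spx (quotient_nerve C)) (face j (mate M t))) < weight pS
      satF (Tagged (spx (quotient_nerve C)) t))%N.
  by move=> [nt tt] jt _; exact: weight_face.
split.
  exists M; split; last by exists v.
  have [m1 m2 m3] := matching; split=> //.
  exact: (no_infinite_path matching w_dim w_face).
apply: (@matching_contractible _ _ (@rank_act _ _ _ _ _ pS satF)
  (@rank_lt _ _ _ _ _ pS satF) _ matching _ w_dim w_face _ vE R).
exists ((#|S| * #|S|.+1) * (#|S| * #|S|).+1)%N => t [nt _].
exact: weight_bound.
Qed.
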